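(* Let $X$ be a 2-dimensional cell complex, $\Lambda\subset X^{(1)}$ a subgraph of its 1-skeleton, and $\lambda\in C^1(\Lambda;\mathbb{Z}_2)$. Let $D\subset X$ be a cellular disc whose boundary circle $\partial D$ lies entirely in $\Lambda$. Then the connecting homomorphism $$\delta^*: H^1(\partial D;\mathbb{Z}_2)\to H^2(D,\partial D;\mathbb{Z}_2)$$ is an isomorphism, and both groups are isomorphic to $\mathbb{Z}_2$. Moreover, if the boundary holonomy satisfies $\sum_{e\in\partial D}\lambda(e)=1$, then for every extension $\tilde\lambda\in C^1(X;\mathbb{Z}_2)$ of $\lambda$ the curvature $\mu=\delta\tilde\lambda$ satisfies $\sum_{f\subset D}\mu(f)=1$; in particular at least one 2-cell $f$ of $D$ is frustrated, i.e. $\mu(f)=1$.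
   Context: Cohomology is cellular cohomology with coefficients in $\mathbb{Z}_2=\mathbb{Z}/2\mathbb{Z}$; $C^k(X;\mathbb{Z}_2)$ is the set of functions from $k$-cells to $\mathbb{Z}_2$, and $\delta$ is the cellular coboundary, $(\delta c)(f)=\sum_{e\subset\partial f}c(e)$. A cellular disc $D\subset X$ is a (finite) subcomplex homeomorphic to a closed 2-disc, with boundary circle $\partial D$ a subcomplex. An extension $\tilde\lambda$ of $\lambda$ agrees with $\lambda$ on the edges of $\Lambda$ and is arbitrary on the other edges of $X$. $\delta^*$ is the connecting homomorphism in the long exact sequence of the pair $(D,\partial D)$: extend a cocycle on $\partial D$ arbitrarily to a cochain on $D$ and take its coboundary. *)

(* Defs.v *)
From HB Require Import structures.
From mathcomp Require Import all_boot all_order all_algebra.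
From mathcomp Require Import all_classical all_reals all_analysis.

Set Implicit Arguments.
Unset Strict Implicit.
Unset Printing Implicit Defensive.

Import Order.TTheory GRing.Theory Num.Theory.
Import numFieldNormedType.Exports.
Import Quotient.

Local Open Scope classical_set_scope.
Local Open Scope ring_scope.
Local Open Scope quotient_scope.

(* Euclidean balls and spheres; the library norm on row vectors is the sup
   norm, hence the explicit sums of squares. *)
Section Balls.
Context {R : realType}.

Definition sqnorm k (x : 'rV[R]_k) : R := \sum_(i < k) x 0 i ^+ 2.

Definition cball k : set 'rV[R]_k := [set x | sqnorm x <= 1].
Definition oball k : set 'rV[R]_k := [set x | sqnorm x < 1].
Definition usphere k : set 'rV[R]_k := [set x | sqnorm x = 1].

Definition circle_pt (t : R) : 'rV[R]_2 :=
  \row_i (if i == 0 then cos t else sin t).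

End Balls.

Definition homeomorphism_on (S T : topologicalType) (A : set S) (B : set T)
    (h : S -> T) : Prop :=
  [/\ set_bij A B h, {within A, continuous h} &
      exists2 g : T -> S, {within B, continuous g} & {in A, cancel h g}].

(* CW complexes of dimension at most 2, possibly infinite, presented by
   characteristic maps.  Only the restriction of [char s] to [cball k] is
   meaningful.  That [char s] is a homeomorphism from the open ball onto the
   open cell follows from compactness of the closed ball and [space_hausdorff]. *)
Record cellComplex2 (R : realType) := CellComplex2 {
  space :> topologicalType;
  space_hausdorff : hausdorff_space space;
  cell : nat -> choiceType;
  char : forall k, cell k -> 'rV[R]_k -> space;
  cell_dim : forall k, cell k -> (k <= 2)%N;
  char_continuous : forall k (s : cell k),
    {within @cball R k, continuous (char s)};
  char_inj : forall k (s : cell k), {in @oball R k &, injective (char s)};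
  cell_disjoint : forall k (s : cell k) l (t : cell l),
    (char s @` @oball R k) `&` (char t @` @oball R l) !=set0 ->
    existT cell k s = existT cell l t;
  cell_cover : forall x : space,
    exists k (s : cell k), (char s @` @oball R k) x;
  char_boundary : forall k (s : cell k) u, @usphere R k u ->
    exists l (t : cell l), (l < k)%N /\ (char t @` @oball R l) (char s u);
  closure_finite : forall k (s : cell k) l,
    finite_set [set t : cell l |
      (char s @` @usphere R k) `&` (char t @` @oball R l) !=set0];
  weak_topology : forall A : set space,
    (forall k (s : cell k), closed (@cball R k `&` char s @^-1` A)) -> closed A
}.

Section CellComplex.
Context {R : realType} {X : cellComplex2 R}.

Definition open_cell k (s : cell X k) : set X := char s @` @oball R k.

Definition boundary_cells k (s : cell X k) l : set (cell X l) :=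
  [set t | (char s @` @usphere R k) `&` open_cell t !=set0].
#[global] Arguments boundary_cells {k} s l _.

Definition attaching_loop (f : cell X 2) (t : R) : X := char f (circle_pt t).

(* [collapse_lift f e g] : g lifts to the reals the composite
     [0, 2 pi] -> X^(1) -> X^(1) / (X^(1) \ e) = R / 2Z
   of the attaching loop of f with the map that collapses the complement of the
   open edge e (parametrized by ]-1, 1[) to the class of odd integers. *)
Definition collapse_lift (f : cell X 2) (e : cell X 1) (g : R -> R) : Prop :=
  {within `[0, 2 * pi]%classic, continuous g} /\
  forall t, 0 <= t <= 2 * pi ->
    exists n : int, let s := g t - (2 * n)%:~R in
      (`|s| < 1 /\ attaching_loop f t = char e (const_mx s)) \/
      (s = 1 /\ ~ open_cell e (attaching_loop f t)).

(* The algebraic number of times the boundary of f runs through e.  Lifts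
   exist and their increments agree, so the default value is never used. *)
Definition attaching_degree (f : cell X 2) (e : cell X 1) : int :=
  xget 0 [set d : int | exists2 g, collapse_lift f e g &
                          g (2 * pi) - g 0 = (2 * d)%:~R].

(* Incidence numbers mod 2; when the closed cell f is embedded, the incidence
   of f and e is 1 exactly when e lies in the boundary of f. *)
Definition incidence k : cell X k.+1 -> cell X k -> 'Z_2 :=
  match k with
  | 0 => fun e v =>
      (`[< open_cell v (char e (const_mx 1)) >] : nat)%:R +
      (`[< open_cell v (char e (const_mx (-1))) >] : nat)%:R
  | 1 => fun f e => (attaching_degree f e)%:~R
  | _ => fun _ _ => 0
  end.

Definition coboundary k (c : cell X k -> 'Z_2) : cell X k.+1 -> 'Z_2 :=
  fun s => \sum_(t \in boundary_cells s k) incidence s t * c t.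

Definition union_cells (Y : forall k, set (cell X k)) : set X :=
  [set x | exists k (s : cell X k), Y k s /\ open_cell s x].

Lemma coboundaryD k (c d : cell X k -> 'Z_2) s :
  coboundary (fun t => c t + d t) s = coboundary c s + coboundary d s.
Proof.
rewrite /coboundary !(fsbig_finite _ _ (@closure_finite _ _ _ s k)) -big_split /=.
by apply: eq_bigr => t _; rewrite mulrDr.
Qed.

Lemma coboundaryN k (c : cell X k -> 'Z_2) s :
  coboundary (fun t => - c t) s = - coboundary c s.
Proof.
rewrite /coboundary !(fsbig_finite _ _ (@closure_finite _ _ _ s k)) -sumrN /=.
by apply: eq_bigr => t _; rewrite mulrN.
Qed.

Lemma eq_coboundary k (c d : cell X k -> 'Z_2) s :
  {in boundary_cells s k, c =1 d} -> coboundary c s = coboundary d s.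
Proof.
by move=> cd; apply: eq_fsbigr => t ts; rewrite cd.
Qed.

End CellComplex.

Record subcomplex (R : realType) (X : cellComplex2 R) := Subcomplex {
  subcells :> forall k, set (cell X k);
  subcells_closed : forall k (s : cell X k), @subcells k s ->
    char s @` @cball R k `<=` union_cells (@subcells)
}.
Arguments subcells {R X} _ k _.

Section Subcomplexes.
Context {R : realType} {X : cellComplex2 R}.
Implicit Types Y A : subcomplex X.

Lemma empty_subcells_closed k (s : cell X k) : set0 s ->
  char s @` @cball R k `<=` union_cells (fun=> set0).
Proof. by []. Qed.

Definition empty_subcomplex : subcomplex X := Subcomplex empty_subcells_closed.

Definition sub_subcomplex A Y : Prop := forall k, A k `<=` Y k.

Definition is_subgraph Y : Prop := forall k, (1 < k)%N -> Y k = set0.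

Lemma boundary_subcells Y k (s : cell X k) l (t : cell X l) :
  Y k s -> boundary_cells s l t -> Y l t.
Proof.
move=> Ys [x [[u su <-] tx]].
have /(subcells_closed Ys)[m [t' [Yt' t'x]]] : (char s @` @cball R k) (char s u).
  by exists u => //; rewrite /cball /= (su : sqnorm u = 1).
have E : existT (cell X) m t' = existT (cell X) l t.
  by apply: cell_disjoint; exists (char s u).
have := projT2_eq E; move: (projT1_eq E) => /= eml.
by case: _ / eml t {tx E} => t /= <-.
Qed.

End Subcomplexes.

Section Cochains.
Context {R : realType} {X : cellComplex2 R}.
Implicit Types Y A : subcomplex X.

Definition cochain Y k : Type := Y k -> 'Z_2.
HB.instance Definition _ Y k := GRing.Zmodule.on (cochain Y k).

Definition extend0 Y k (c : cochain Y k) : cell X k -> 'Z_2 :=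
  fun s => if insub s is Some s' then c s' else 0.

(* Since Y contains the boundary cells of its cells, the values of c outside
   Y play no role: extension by zero only serves to reuse [coboundary]. *)
Definition sub_coboundary Y k (c : cochain Y k) : cochain Y k.+1 :=
  fun s => coboundary (extend0 c) (val s).

(* C^k(Y, A) as a subgroup of C^k(Y) *)
Definition rel_cochain Y A k : {pred cochain Y k} :=
  fun c => `[< forall s : Y k, A k (val s) -> c s = 0 >].
#[global] Arguments rel_cochain Y A k _ : clear implicits.

Definition is_cocycle Y A k : {pred cochain Y k} :=
  fun c => (c \in rel_cochain Y A k) && (sub_coboundary c == 0).
#[global] Arguments is_cocycle Y A k _ : clear implicits.

Lemma extend0E Y k (c : cochain Y k) (s : Y k) : extend0 c (val s) = c s.
Proof. by rewrite /extend0 valK. Qed.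

Lemma extend0D Y k (c d : cochain Y k) :
  extend0 (c + d) = fun s => extend0 c s + extend0 d s.
Proof.
by apply/funext => s; rewrite /extend0; case: insub => //; rewrite addr0.
Qed.

Lemma extend0N Y k (c : cochain Y k) : extend0 (- c) = fun s => - extend0 c s.
Proof.
by apply/funext => s; rewrite /extend0; case: insub => //; rewrite oppr0.
Qed.

Lemma sub_coboundaryB Y k : zmod_morphism (@sub_coboundary Y k).
Proof.
move=> c d; apply/funext => s.
by rewrite /sub_coboundary extend0D extend0N coboundaryD coboundaryN.
Qed.

HB.instance Definition _ Y k :=
  GRing.isZmodMorphism.Build (cochain Y k) (cochain Y k.+1)
    (@sub_coboundary Y k) (@sub_coboundaryB Y k).

Lemma rel_cochain_zmod Y A k : zmod_closed (rel_cochain Y A k).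
Proof.
split; first exact/asboolP.
move=> c d /asboolP c0 /asboolP d0; apply/asboolP => s As.
by rewrite [LHS](_ : _ = c s - d s)// c0// d0// subr0.
Qed.

HB.instance Definition _ Y A k :=
  GRing.isZmodClosed.Build (cochain Y k) (rel_cochain Y A k)
    (@rel_cochain_zmod Y A k).

Lemma is_cocycle_zmod Y A k : zmod_closed (is_cocycle Y A k).
Proof.
split; first by rewrite unfold_in rpred0 raddf0 eqxx.
move=> c d /andP[cA /eqP c0] /andP[dA /eqP d0].
by rewrite unfold_in rpredB//= raddfB/= c0 d0 subr0.
Qed.

HB.instance Definition _ Y A k :=
  GRing.isZmodClosed.Build (cochain Y k) (is_cocycle Y A k)
    (@is_cocycle_zmod Y A k).

(* Z^k(Y, A) *)
Record cocycle Y A k : Type := Cocycle {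
  cocycle_val :> cochain Y k;
  cocycle_valP : cocycle_val \in is_cocycle Y A k
}.

HB.instance Definition _ Y A k := [isSub for @cocycle_val Y A k].
HB.instance Definition _ Y A k := [Choice of cocycle Y A k by <:].
HB.instance Definition _ Y A k :=
  [SubChoice_isSubZmodule of cocycle Y A k by <:].

(* B^k(Y, A) inside Z^k(Y, A) *)
Definition coboundaries Y A k : {pred cocycle Y A k} :=
  match k return {pred cocycle Y A k} with
  | 0 => fun z => z == 0
  | k'.+1 => fun z => `[< exists2 b : cochain Y k', b \in rel_cochain Y A k' &
                            cocycle_val z = sub_coboundary b >]
  end.
#[global] Arguments coboundaries Y A k _ : clear implicits.

Lemma coboundaries_zmod Y A k : zmod_closed (coboundaries Y A k).
Proof.
case: k => [|k]; split.
- exact: eqxx.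
- by move=> y z /eqP -> /eqP ->; rewrite subr0; exact: eqxx.
- by apply/asboolP; exists 0; [exact: rpred0|rewrite raddf0].
- move=> y z /asboolP[b bA yb] /asboolP[c cA zc]; apply/asboolP.
  exists (b - c); first exact: rpredB.
  by rewrite raddfB /= -yb -zc.
Qed.

HB.instance Definition _ Y A k :=
  GRing.isZmodClosed.Build (cocycle Y A k) (coboundaries Y A k)
    (@coboundaries_zmod Y A k).

Definition rel_cohomology Y A k : zmodType := {quot (coboundaries Y A k)}.

Definition cohomology Y k : zmodType := rel_cohomology Y empty_subcomplex k.

Definition cohomology_class Y A k (z : cocycle Y A k) : rel_cohomology Y A k :=
  \pi_({quot (coboundaries Y A k)}) z.

End Cochains.

Definition extends_cochain (R : realType) (X : cellComplex2 R)
    (A Y : subcomplex X) k (c : cochain A k) (d : cochain Y k) : Prop :=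
  forall (s : A k) (t : Y k), val t = val s -> d t = c s.

Section Connecting.
Context {R : realType} {X : cellComplex2 R}.
Variables (Y A : subcomplex X) (AY : sub_subcomplex A Y).

Let Z1A := cocycle A empty_subcomplex 1.

Lemma coboundary_extension_cocycle (c : Z1A) (d : cochain Y 1) :
  extends_cochain c d -> sub_coboundary d \in is_cocycle Y A 2.
Proof.
move=> cd; apply/andP; split.
  apply/asboolP => s As; have /andP[_ /eqP c0] := cocycle_valP c.
  pose s' : A 2 := SigSub (mem_set As).
  have <- : sub_coboundary c s' = 0 by rewrite c0.
  apply: eq_coboundary => t /set_mem ts.
  have At := boundary_subcells As ts.
  have Yt := AY At.
  rewrite -[t]/(val (SigSub (mem_set Yt) : Y 1)) extend0E.
  by rewrite (cd (SigSub (mem_set At)))// -extend0E.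
by apply/eqP/funext => s; apply: fsbig1 => t _; rewrite mul0r.
Qed.

(* As every class has a representative and every cochain of A extends to Y,
   at most one map f satisfies this. *)
Definition is_connecting (f : cohomology A 1 -> rel_cohomology Y A 2) : Prop :=
  forall (c : Z1A) (d : cochain Y 1) (cd : extends_cochain c d),
    f (cohomology_class c) =
    cohomology_class (Cocycle (coboundary_extension_cocycle cd)).

End Connecting.

Definition isomorphic (U V : zmodType) : Prop :=
  exists f : {additive U -> V}, bijective f.

(* The boundary circle is recorded as a subcomplex; [disc_homeo] pins it down
   as the image of the unit circle. *)
Record cellularDisc (R : realType) (X : cellComplex2 R) := CellularDisc {
  disc :> subcomplex X;
  disc_boundary : subcomplex X;
  disc_finite : forall k, finite_set (disc k);
  disc_boundary_sub : sub_subcomplex disc_boundary disc;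
  disc_homeo : exists2 h : 'rV[R]_2 -> X,
    homeomorphism_on (@cball R 2) (union_cells disc) h &
    h @` @usphere R 2 = union_cells disc_boundary
}.
Arguments disc_finite {R X} c k.
Arguments disc_boundary_sub {R X} c.

(* Main.v *)
Require Import Defs.
From HB Require Import structures.
From mathcomp Require Import all_boot all_order all_algebra.
From mathcomp Require Import finmap.
From mathcomp Require Import all_classical all_reals all_analysis.
From mathcomp Require Import ring lra zify.

(* The whole argument runs on winding numbers of maps to the circle R/2Z,
   lifted to the reals.  Circle-valued maps on a finite graph are classified, up
   to real-valued maps, by integral 1-cochains, and the winding number of such a
   map along a loop is the pairing of its cochain with the edge degrees of the
   loop; so an integral 1-cochain is a cocycle of the disc D iff its circle map
   extends over the faces of D.  As D is contractible the extension lifts to R,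
   hence integral cocycles of D are coboundaries.  In the chart of D, the angle
   seen from the center of a face f winds an odd number of times around f (for an
   injective map g of the disc, g(x) - g(0) is homotopic, away from 0, to the odd
   map g(x) - g(-x)), not at all around the other faces, and once around the boundary
   of D.  Its cochain therefore kills the class dual to f modulo 2.  It follows
   that H^1(D) = H^2(D) = 0 modulo 2, which makes the connecting map bijective,
   and pairing these cochains with the boundary circle gives the curvature
   formula. *)

Set Implicit Arguments.
Unset Strict Implicit.
Unset Printing Implicit Defensive.

Import Order.TTheory GRing.Theory Num.Theory.
Import numFieldNormedType.Exports.

Local Open Scope classical_set_scope.
Local Open Scope ring_scope.

(** Attaching maps are only assumed continuous, so the passages of a face through an edge cannot be
    counted combinatorially, and incidence numbers are accessible only as winding numbers. A cochain
    modulo 2 defines no map to the circle, hence the detour through integral cochains. The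
    comparison of a face with an odd map is elementary but yields only that its winding number is
    odd, not that it is 1 or -1. The cochains attached to the faces are therefore not an integral
    dual basis, and dividing by odd numbers, harmless modulo 2, has to be done over the integers by
    clearing denominators. The group H^2(D, B), B being the boundary circle, is not computed by
    itself: H^1(B) is identified with 'Z_2 by summing over the boundary edges, which is legitimate
    because the boundary loop runs through each of them an odd number of times, and the result is
    carried over by the connecting map. *)

Section Within.
Context {S T U : topologicalType}.

Lemma within_continuous_comp (A : set S) (B : set T) (f : S -> T) (g : T -> U) :
  {within A, continuous f} -> {within B, continuous g} ->
  (forall x, A x -> B (f x)) -> {within A, continuous (g \o f)}.
Proof.
move=> /subspace_continuousP cf /subspace_continuousP cg AB.
apply/subspace_continuousP => x Ax V /(cg _ (AB _ Ax)) BV.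
have := cf _ Ax _ BV; rewrite /= !nbhs_simpl /=.
apply: filterS2 (withinT _ _) => y /= Ay By; apply: By; exact: AB.
Qed.

Lemma eq_within_continuous (A : set S) (f g : S -> T) :
  (forall x, A x -> f x = g x) ->
  {within A, continuous f} -> {within A, continuous g}.
Proof. by move=> fg; apply: subspace_eq_continuous => x /set_mem; exact: fg. Qed.

Lemma closed_within_continuous (A : set S) (f : S -> T) :
  (forall C, closed C -> closed (A `&` f @^-1` C)) ->
  {within A, continuous f}.
Proof.
move=> cA; apply/continuous_closedP => C /cA cAC; apply/closed_subspaceP.
by exists (A `&` f @^-1` C) => //; rewrite setIAC setIid setIC.
Qed.

Lemma within_compact_preimage (A : set S) (f : S -> T) (C : set T) :
  compact A -> closed A -> {within A, continuous f} -> closed C ->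
  compact (A `&` f @^-1` C).
Proof.
move=> kA cA /continuous_closedP cf /cf /closed_subspaceP[V cV VA].
apply: (subclosed_compact _ kA); last by move=> x [].
by rewrite setIC -[X in X `&` _]/(f @^-1` C) -VA; exact: closedI.
Qed.
End Within.

Section WithinReal.
Context {R : realType} {T : topologicalType}.
Implicit Types (A : set T) (f g : T -> R).

Lemma within_cst A (c : R) : {within A, continuous (fun=> c)}.
Proof. by apply: continuous_subspaceT => x; exact: cvg_cst. Qed.

Lemma withinD A f g : {within A, continuous f} -> {within A, continuous g} ->
  {within A, continuous (fun x => f x + g x)}.
Proof. by move=> cf cg x; apply: continuousD; [exact: cf|exact: cg]. Qed.

Lemma withinB A f g : {within A, continuous f} -> {within A, continuous g} ->
  {within A, continuous (fun x => f x - g x)}.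
Proof. by move=> cf cg x; apply: continuousB; [exact: cf|exact: cg]. Qed.

Lemma withinM A f g : {within A, continuous f} -> {within A, continuous g} ->
  {within A, continuous (fun x => f x * g x)}.
Proof. by move=> cf cg x; apply: continuousM; [exact: cf|exact: cg]. Qed.

Lemma withinV A f : {within A, continuous f} -> (forall x, A x -> f x != 0) ->
  {within A, continuous (fun x => (f x)^-1)}.
Proof.
move=> /subspace_continuousP cf f0; apply/subspace_continuousP => x Ax.
by apply: cvgV; [exact: f0|exact: cf].
Qed.

Lemma within_sum A (I : Type) (r : seq I) (F : I -> T -> R) :
  (forall i, {within A, continuous (F i)}) ->
  {within A, continuous (fun x => \sum_(i <- r) F i x)}.
Proof.
move=> cF; elim: r => [|i r IH].
  by apply: (eq_within_continuous _ (@within_cst A 0)) => x _; rewrite big_nil.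
by apply: (eq_within_continuous _ (withinD (cF i) IH)) => x _; rewrite big_cons.
Qed.

Lemma within_comp1 A f (g : R -> R) :
  {within A, continuous f} -> continuous g -> {within A, continuous (g \o f)}.
Proof.
move=> cf cg; apply: (within_continuous_comp cf (B := setT)) => //.
exact: continuous_subspaceT.
Qed.
End WithinReal.

(** * Congruence modulo 2 of real numbers, and angles in units of pi *)

Section Congruence.
Context {R : realType}.
Implicit Types a b c d : R.

(** Equality in R/2Z. The period is 2 because edges are parametrized by ]-1, 1[, and collapsing the
    complement of an edge identifies -1 with 1; multiplication by pi turns a class into an angle. *)
Definition congr2 a b : bool := (a - b) / 2 \is a Num.int.

Lemma congr2P a b : reflect (exists n : int, a - b = (2 * n)%:~R) (congr2 a b).
Proof.
apply: (iffP intrP) => -[n e]; exists n.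
  by rewrite intrM -e mulrCA divff ?mulr1 ?pnatr_eq0.
by rewrite e intrM mulrAC divff ?mul1r ?pnatr_eq0.
Qed.

Lemma congr2_refl a : congr2 a a.
Proof. by rewrite /congr2 subrr mul0r. Qed.

Lemma congr2_sym a b : congr2 a b = congr2 b a.
Proof. by rewrite /congr2 -rpredN -mulNr opprB. Qed.

Lemma congr2_trans b a c : congr2 a b -> congr2 b c -> congr2 a c.
Proof.
move=> ab bc; rewrite /congr2 (_ : (a - c) / 2 = (a - b) / 2 + (b - c) / 2).
  exact: rpredD.
by rewrite -mulrDl addrA subrK.
Qed.

Lemma congr2D a b c d : congr2 a b -> congr2 c d -> congr2 (a + c) (b + d).
Proof.
move=> ab cd; rewrite /congr2.
rewrite (_ : (a + c - (b + d)) / 2 = (a - b) / 2 + (c - d) / 2); last by ring.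
exact: rpredD.
Qed.

Lemma congr2N a b : congr2 a b -> congr2 (- a) (- b).
Proof. by move=> ab; rewrite /congr2 -opprD mulNr rpredN. Qed.

Lemma congr2B a b c d : congr2 a b -> congr2 c d -> congr2 (a - c) (b - d).
Proof. by move=> ab cd; exact: congr2D ab (congr2N cd). Qed.

Lemma congr2M (n : int) a b : congr2 a b -> congr2 (n%:~R * a) (n%:~R * b).
Proof.
by move=> ab; rewrite /congr2 -mulrBr -mulrA rpredM// intr_int.
Qed.

Lemma congr2_sum (I : Type) (r : seq I) (F G : I -> R) :
  (forall i, congr2 (F i) (G i)) -> congr2 (\sum_(i <- r) F i) (\sum_(i <- r) G i).
Proof.
by move=> FG; elim/big_ind2 : _ => // [|*]; [exact: congr2_refl|exact: congr2D].
Qed.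

Lemma congr2_int2 (n : int) a : congr2 (a + (2 * n)%:~R) a.
Proof. by apply/congr2P; exists n; rewrite addrC addKr. Qed.

Lemma congr2_0int (n : int) : congr2 ((2 * n)%:~R) 0.
Proof. by rewrite -[_%:~R]add0r; exact: congr2_int2. Qed.

Lemma cosDint (a : R) (n : int) : cos (a + n%:~R * (pi *+ 2)) = cos a.
Proof.
have H (m : nat) (b : R) : cos (b + m%:R * (pi *+ 2)) = cos b.
  elim: m b => [|m IH] b; first by rewrite mul0r addr0.
  by rewrite -natr1 mulrDl mul1r addrA cosD2pi IH.
case: n => n; first exact: H.
by rewrite NegzE -[LHS](H n.+1) mulrNz mulNr pmulrn subrK.
Qed.

Lemma sinDint (a : R) (n : int) : sin (a + n%:~R * (pi *+ 2)) = sin a.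
Proof.
have H (m : nat) (b : R) : sin (b + m%:R * (pi *+ 2)) = sin b.
  elim: m b => [|m IH] b; first by rewrite mul0r addr0.
  by rewrite -natr1 mulrDl mul1r addrA sinD2pi IH.
case: n => n; first exact: H.
by rewrite NegzE -[LHS](H n.+1) mulrNz mulNr pmulrn subrK.
Qed.

Lemma congr2_cos a b : congr2 a b -> cos (pi * a) = cos (pi * b).
Proof.
case/congr2P => n e; have -> : a = b + (2 * n)%:~R by rewrite -e addrC subrK.
rewrite mulrDr intrM (_ : pi * (_ * _) = n%:~R * (pi *+ 2)) ?cosDint//.
by rewrite mulr2n; ring.
Qed.

Lemma congr2_sin a b : congr2 a b -> sin (pi * a) = sin (pi * b).
Proof.
case/congr2P => n e; have -> : a = b + (2 * n)%:~R by rewrite -e addrC subrK.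
rewrite mulrDr intrM (_ : pi * (_ * _) = n%:~R * (pi *+ 2)) ?sinDint//.
by rewrite mulr2n; ring.
Qed.

(** Injectivity of the cosine holds on [0, pi] only, so x is reduced to y in [0, 2[, and y > 1 is
    reflected to 2 - y. *)
Lemma cos_eq1 x : cos (pi * x) = 1 -> congr2 x 0.
Proof.
move=> cx; set n := Num.floor (x / 2); set y := x - (2 * n)%:~R.
have xy : congr2 x y by apply/congr2P; exists n; rewrite /y opprB addrC subrK.
rewrite (congr2_cos xy) in cx; apply: congr2_trans xy _.
have /andP[n1 n2] := floor_itv (x / 2).
have y0 : 0 <= y.
  rewrite subr_ge0 intrM mulrC -ler_pdivlMr ?ltr0n//; exact: n1.
have y2 : y < 2.
  rewrite /y ltrBlDr intrM -[X in X + _]mulr1 -mulrDr mulrC.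
  by rewrite -ltr_pdivrMr ?ltr0n// addrC -intrD1.
have pi0 := @pi_gt0 R.
have [y1|y1] := leP y 1.
  have : pi * y = 0.
    apply: cos_inj; rewrite ?in_itv/= ?cx ?cos0 ?lexx ?(ltW pi0)//.
    by rewrite mulr_ge0 ?ler_piMr// ltW.
  by move/eqP; rewrite mulf_eq0 gt_eqF//= => /eqP ->; exact: congr2_refl.
have : pi * (2 - y) = 0.
  apply: cos_inj; rewrite ?in_itv/= ?lexx ?(ltW pi0)//.
    by rewrite mulr_ge0 ?ler_piMr// ?ltW//; lra.
  rewrite cos0 -cosN -mulrN opprB -[RHS]cx; apply: congr2_cos.
  by apply/congr2P; exists (-1); rewrite mulrN1 intrN addrAC subrr add0r.
move/eqP; rewrite mulf_eq0 gt_eqF//= => /eqP e.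
by lra.
Qed.

Lemma cos_sin_congr2 a b :
  cos (pi * a) = cos (pi * b) -> sin (pi * a) = sin (pi * b) -> congr2 a b.
Proof.
move=> ec es; have : congr2 (a - b) 0.
  by apply: cos_eq1; rewrite mulrBr cosB ec es -!expr2 cos2Dsin2.
by rewrite /congr2 subr0.
Qed.

Lemma unit_circle_angle (x y : R) : x ^+ 2 + y ^+ 2 = 1 ->
  exists a, x = cos (pi * a) /\ y = sin (pi * a).
Proof.
move=> xy; have x1 : -1 <= x <= 1.
  rewrite -ler_norml -sqrtr_sqr -[leRHS]sqrtr1 ler_sqrt ?ler01//.
  by rewrite -xy lerDl sqr_ge0.
have xI : x \in `[(-1), 1] by rewrite in_itv.
have pi0 : pi != 0 :> R by rewrite gt_eqF ?pi_gt0.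
have sx : sin (acos x) = `|y|.
  by rewrite sin_acos// -sqrtr_sqr; congr Num.sqrt; rewrite -xy addrC addKr.
have [y0|y0] := leP 0 y.
  exists (acos x / pi); rewrite mulrCA divff// mulr1 acosK//; split=> //.
  by rewrite sx ger0_norm.
exists (- (acos x / pi)); rewrite mulrN mulrCA divff// mulr1 cosN sinN acosK//.
by split=> //; rewrite sx ltr0_norm// opprK.
Qed.

End Congruence.

(** * Maps to the circle and their lifts *)

Section CircleMaps.
Context {R : realType}.

(* A map to the circle R/2Z is encoded by an arbitrary real-valued
   representative [F], continuity being that of the induced map. *)
Definition circle_continuous (T : topologicalType) (A : set T) (F : T -> R) :=
  {within A, continuous (fun x => cos (pi * F x))} /\
  {within A, continuous (fun x => sin (pi * F x))}.

Section Topological.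
Context {T : topologicalType}.
Implicit Types (A : set T) (F G : T -> R).

Lemma within_circle_continuous A F :
  {within A, continuous F} -> circle_continuous A F.
Proof.
move=> cF; have cpF : {within A, continuous (fun x => pi * F x)}.
  exact: withinM (@within_cst _ _ _ _) cF.
by split; apply: (within_comp1 cpF); [exact: continuous_cos|exact: continuous_sin].
Qed.

Lemma eq_circle_continuous A F G : (forall x, A x -> congr2 (F x) (G x)) ->
  circle_continuous A F -> circle_continuous A G.
Proof.
move=> FG [cF sF]; split.
- by apply: (eq_within_continuous _ cF) => x /FG/congr2_cos.
- by apply: (eq_within_continuous _ sF) => x /FG/congr2_sin.
Qed.

Lemma circle_continuousD A F G : circle_continuous A F ->
  circle_continuous A G -> circle_continuous A (fun x => F x + G x).
Proof.
move=> [cF sF] [cG sG]; split.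
- apply: (eq_within_continuous _ (withinB (withinM cF cG) (withinM sF sG))).
  by move=> x _; rewrite mulrDr cosD.
- apply: (eq_within_continuous _ (withinD (withinM sF cG) (withinM cF sG))).
  by move=> x _; rewrite mulrDr sinD.
Qed.

Lemma circle_continuousN A F :
  circle_continuous A F -> circle_continuous A (fun x => - F x).
Proof.
move=> [cF sF]; split.
- by apply: (eq_within_continuous _ cF) => x _; rewrite mulrN cosN.
- apply: (eq_within_continuous _ (withinB (@within_cst _ _ _ 0) sF)) => x _.
  by rewrite sub0r mulrN sinN.
Qed.

Lemma circle_continuousB A F G : circle_continuous A F ->
  circle_continuous A G -> circle_continuous A (fun x => F x - G x).
Proof. by move=> cF cG; exact: circle_continuousD cF (circle_continuousN cG). Qed.

Lemma circle_continuousM A F (n : int) :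
  circle_continuous A F -> circle_continuous A (fun x => n%:~R * F x).
Proof.
move=> cF; have H (m : nat) : circle_continuous A (fun x => m%:R * F x).
  elim: m => [|m IH].
    apply: (eq_circle_continuous _ (within_circle_continuous (@within_cst _ _ _ 0))).
    by move=> x _; rewrite mul0r congr2_refl.
  apply: (eq_circle_continuous _ (circle_continuousD IH cF)) => x _.
  by rewrite -natr1 mulrDl mul1r congr2_refl.
case: n => n; first exact: H.
apply: (eq_circle_continuous _ (circle_continuousN (H n.+1))) => x _.
by rewrite NegzE mulrNz mulNr congr2_refl.
Qed.

Lemma circle_continuous_sum A (I : Type) (r : seq I) (F : I -> T -> R) :
  (forall i, circle_continuous A (F i)) ->
  circle_continuous A (fun x => \sum_(i <- r) F i x).
Proof.
move=> cF; elim: r => [|i r IH].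
  apply: (eq_circle_continuous _ (within_circle_continuous (@within_cst _ _ _ 0))).
  by move=> x _; rewrite big_nil congr2_refl.
apply: (eq_circle_continuous _ (circle_continuousD (cF i) IH)) => x _.
by rewrite big_cons congr2_refl.
Qed.

End Topological.

Lemma circle_continuous_comp (S T : topologicalType) (A : set S) (B : set T)
    (f : S -> T) (F : T -> R) :
  {within A, continuous f} -> circle_continuous B F ->
  (forall x, A x -> B (f x)) -> circle_continuous A (F \o f).
Proof.
by move=> cf [cF sF] AB; split;
  [exact: within_continuous_comp cf cF AB|exact: within_continuous_comp cf sF AB].
Qed.

Lemma compact_unif_continuous (V : normedModType R) (K : set V) (f : V -> R) :
  compact K -> {within K, continuous f} -> forall e : R, 0 < e ->
  exists2 d : R, 0 < d &
    forall x y, K x -> K y -> `|x - y| < d -> `|f x - f y| < e.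
Proof.
move=> /compact_near_coveringP/near_covering_withinP cK.
move=> /subspace_continuousP cf e e0.
pose P (d : R) (x : V) := forall y, K y -> `|x - y| < d -> `|f x - f y| < e.
have : \forall d \near 0^'+, K `<=` P d.
  apply: cK => x Kx; have e20 : 0 < e / 2 by rewrite divr_gt0.
  have /cf : K x by [].
  move=> /cvgrPdist_lt/(_ _ e20); rewrite near_withinE near_nbhs => /nbhs_ballP.
  move=> [r /= r0 xr]; have r20 : 0 < r / 2 by rewrite divr_gt0.
  exists (ball x (r / 2), [set d | d < r / 2]).
    split; first exact: nbhsx_ballx.
    exact: nbhs_right_lt.
  move=> [x' d] [/= xx' dr] Kx' y Ky x'y.
  have fx' : `|f x - f x'| < e / 2.
    by apply: xr => //; apply: le_ball xx'; lra.
  have fy : `|f x - f y| < e / 2.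
    apply: xr => //; rewrite [r]splitr; apply: ball_triangle xx' _.
    by rewrite -ball_normE /ball_/=; exact: lt_trans x'y dr.
  rewrite [e]splitr (le_lt_trans _ (ltrD fx' fy))//.
  by rewrite [X in _ <= X + _]distrC (le_trans _ (ler_normD _ _))// addrA subrK.
move=> H; near (0 : R)^'+ => d; exists d; first by near: d; exact: nbhs_right_gt.
by move=> x y Kx; have : K `<=` P d by [near: d]; apply.
Unshelve. all: by end_near. Qed.

(** Distinct members of one class modulo 2 are at least 2 apart, so the intermediate value theorem
    would produce the value at distance 1 from [f a] on the side of [f b]. Uniqueness of lifts and
    homotopy invariance both rest on this. *)
Lemma within_constant_even (a b : R) (f : R -> R) : a <= b ->
  {within `[a, b], continuous f} ->
  (forall t, t \in `[a, b] -> congr2 (f t) (f a)) -> f b = f a.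
Proof.
move=> ab cf fZ; apply/eqP; apply: contraT => fab.
pose m := f a + Num.sg (f b - f a).
have [|c cab fc] := @IVT R f a b m ab cf.
  have /congr2P[n fn] : congr2 (f b) (f a) by apply: fZ; rewrite in_itv/= ab lexx.
  have n0 : n != 0 by apply: contraNneq fab => n0; rewrite -subr_eq0 fn n0 mulr0.
  have n1 : 2 <= `|f b - f a|.
    by rewrite fn -intr_norm (ler_int _ 2); lia.
  rewrite /m ge_min le_max; have [d0|d0|d0] := ltrgt0P (f b - f a).
  - rewrite gtr0_sg//; rewrite gtr0_norm // in n1; lra.
  - rewrite ltr0_sg//; rewrite ltr0_norm // in n1; lra.
  - by rewrite d0 normr0 in n1; lra.
have := fZ _ cab; rewrite fc /m /congr2 addrC addKr.
case: sgrP => [e|_|_]; first by move: fab; rewrite -subr_eq0 e eqxx.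
  move=> /intrP[n]; move/(congr1 (fun x => x * 2)); rewrite mulrAC -mulrA divff ?pnatr_eq0// => e.
  have : (1 : int) = n * 2 by apply: (@intr_inj R); rewrite intrM -e mulr1.
  by lia.
move=> /intrP[n]; move/(congr1 (fun x => x * 2)); rewrite mulrAC -mulrA divff ?pnatr_eq0// => e.
have : (- 1 : int) = n * 2 by apply: (@intr_inj R); rewrite intrM -e mulr1 rmorphN1.
by lia.
Qed.
End CircleMaps.

(** * Lifting circle maps to the reals; winding numbers *)

Section Lifting.
Context {R : realType}.

(** On the open right half of the circle the arctangent is a continuous inverse of the angle map:
    this is the local lift from which [circle_lift] is assembled. *)
Lemma atan_congr2 (d : R) : 0 < cos (pi * d) ->
  congr2 (atan (sin (pi * d) / cos (pi * d)) / pi) d.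
Proof.
move=> c0; set t := sin (pi * d) / cos (pi * d).
have pi0 : pi != 0 :> R by rewrite gt_eqF ?pi_gt0.
have ct : cos (atan t) = cos (pi * d).
  rewrite cos_atan (_ : 1 + t ^+ 2 = (cos (pi * d))^-1 ^+ 2).
    by rewrite sqrtr_sqr gtr0_norm ?invr_gt0// invrK.
  rewrite -[RHS]mul1r -[X in _ = X * _](cos2Dsin2 (pi * d)) /t.
  by field; rewrite gt_eqF.
have c1 : cos (atan t) != 0 by rewrite ct gt_eqF.
apply: cos_sin_congr2; rewrite mulrCA divff// mulr1//.
have := atanK t; rewrite /tan ct => /(canRL (divfK _)) -> //.
  by rewrite /t divfK// gt_eqF.
by rewrite gt_eqF.
Qed.

Section Star.
Variables (V : normedModType R) (K : set V) (x0 : V).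
Hypothesis cK : compact K.
Hypothesis (star : forall x t, K x -> 0 <= t <= 1 -> K (x0 + t *: (x - x0))).

(** The chord between the points of angles F x and F y has square 2 - 2 cos (pi (F x - F y)); it is
    below 2 as soon as both coordinates differ by less than 1. *)
Lemma circle_continuous_close (F : V -> R) : circle_continuous K F ->
  exists2 d : R, 0 < d &
    forall x y, K x -> K y -> `|x - y| < d -> 0 < cos (pi * (F x - F y)).
Proof.
move=> [cF sF].
have [d1 d10 H1] := compact_unif_continuous cK cF ltr01.
have [d2 d20 H2] := compact_unif_continuous cK sF ltr01.
exists (Num.min d1 d2); first by rewrite lt_min d10.
move=> x y Kx Ky; rewrite lt_min => /andP[/(H1 _ _ Kx Ky) h1 /(H2 _ _ Kx Ky) h2].
rewrite mulrBr cosB.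
have e1 := cos2Dsin2 (pi * F x); have e2 := cos2Dsin2 (pi * F y).
move: h1 h2; rewrite !ltr_norml => /andP[h1 h1'] /andP[h2 h2'].
nra.
Qed.

(** An explicit formula replaces path lifting: the segment from x0 to x is cut into n equal pieces,
    n independent of x, and the small angle increments, each a continuous function of x, are added
    up. *)
Lemma circle_lift (F : V -> R) : circle_continuous K F ->
  exists2 L : V -> R, {within K, continuous L} &
    forall x, K x -> congr2 (L x) (F x).
Proof.
move=> cF; have [d d0 close] := circle_continuous_close cF.
have [M [Mr KM]] := compact_bounded cK.
pose B := `|M| + 1 + `|x0|.
have KB x : K x -> `|x - x0| <= B.
  move=> Kx; apply: le_trans (ler_normB _ _) _; rewrite lerD2r.
  by apply: (KM (`|M| + 1)) => //; rewrite (le_lt_trans (ler_norm _))// ltrDl.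
have B0 : 0 <= B by rewrite !addr_ge0.
(* B bounds the distance from x0 to the points of K, so with n pieces consecutive points of
   subdivision are less than d apart, uniformly in x. *)
pose n := (Num.truncn (B / d)).+1.
have nB : B < d * n%:R.
  by rewrite mulrC -ltr_pdivrMr// truncnS_gt.
have n0 : 0 < n%:R :> R by rewrite ltr0n.
pose p (t : R) x := x0 + t *: (x - x0).
pose q (j : nat) x := p (j%:R / n%:R) x.
have Kq j x : (j <= n)%N -> K x -> K (q j x).
  by move=> jn Kx; apply: star => //; rewrite divr_ge0//= ler_pdivrMr// mul1r ler_nat.
have cq j : continuous (q j).
  move=> x; apply: cvgD; first exact: cvg_cst.
  by apply: cvgZr; apply: cvgB; [exact: cvg_id|exact: cvg_cst].
pose D j x := F (q j.+1 x) - F (q j x).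
have cD (j : 'I_n) x : K x -> 0 < cos (pi * D j x).
  move=> Kx; apply: close; [exact: Kq|by apply: Kq => //; exact: ltnW|].
  rewrite /q /p opprD addrACA subrr add0r -scalerBl -mulrBl -natr1 addrAC subrr add0r.
  rewrite normrZ mul1r gtr0_norm ?invr_gt0// mulrC ltr_pdivrMr//.
  exact: le_lt_trans (KB _ Kx) nB.
pose tau (a : R) := atan (sin (pi * a) / cos (pi * a)) / pi.
exists (fun x => F x0 + \sum_(j < n) tau (D j x)).
  apply: withinD; first exact: within_cst.
  apply: within_sum => j.
  have [cDj sDj] : circle_continuous K (D j).
    apply: circle_continuousB.
      by apply: (circle_continuous_comp _ cF);
        [apply: continuous_subspaceT; exact: cq|move=> x; exact: Kq].
    by apply: (circle_continuous_comp _ cF);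
        [apply: continuous_subspaceT; exact: cq|move=> x; apply: Kq; exact: ltnW].
  apply: withinM; last exact: within_cst.
  apply: (within_comp1 (f := fun x => sin (pi * D j x) / cos (pi * D j x))).
    by apply: withinM => //; apply: withinV => // x /(cD j); move/gt_eqF => ->.
  by move=> x; exact: continuous_atan.
move=> x Kx; have tele : \sum_(j < n) D j x = F x - F x0.
  rewrite -(big_mkord xpredT (fun j => F (q j.+1 x) - F (q j x))) telescope_sumr//.
  rewrite /q /p divff ?gt_eqF// scale1r mul0r scale0r addr0.
  by rewrite (addrC x0) subrK.
rewrite -[X in congr2 _ X](subrK (F x0)) addrC -tele.
apply: congr2D (congr2_refl _); 
  rewrite [X in congr2 X _](eq_bigr (fun j : 'I_n =>
    if 0 < cos (pi * D j x) then tau (D j x) else D j x)).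
  by apply: congr2_sum => j; case: ifP => [/atan_congr2//|_]; exact: congr2_refl.
by move=> j _; rewrite cD.
Qed.
End Star.


Definition is_lift (F L : R -> R) :=
  {within `[0, 2 * pi]%classic, continuous L} /\
  forall t, 0 <= t <= 2 * pi -> congr2 (L t) (F t).

(* The default value 0 is only taken when [F] is not a [circle_loop]. *)
Definition winding (F : R -> R) : int :=
  xget 0 [set d : int | exists2 L, is_lift F L & L (2 * pi) - L 0 = (2 * d)%:~R].

Definition circle_loop (F : R -> R) :=
  circle_continuous `[0, 2 * pi]%classic F /\ congr2 (F (2 * pi)) (F 0).

Let pi2_ge0 : 0 <= 2 * pi :> R.
Proof. by rewrite mulr_ge0 ?pi_ge0. Qed.

Lemma is_lift_unique F L1 L2 : is_lift F L1 -> is_lift F L2 ->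
  L1 (2 * pi) - L1 0 = L2 (2 * pi) - L2 0.
Proof.
move=> [c1 l1] [c2 l2].
have E : L1 (2 * pi) - L2 (2 * pi) = L1 0 - L2 0.
  apply: (@within_constant_even _ 0 (2 * pi) (fun t => L1 t - L2 t)) => //.
    exact: withinB.
  have H t : 0 <= t <= 2 * pi -> congr2 (L1 t - L2 t) 0.
    by move=> tI; rewrite -(subrr (F t)); apply: congr2B; [exact: l1|exact: l2].
  move=> t; rewrite in_itv/= => tI; apply: congr2_trans (H _ tI) _.
  by rewrite congr2_sym; apply: H; rewrite lexx.
by lra.
Qed.

Lemma windingE F L (d : int) : is_lift F L ->
  L (2 * pi) - L 0 = (2 * d)%:~R -> winding F = d.
Proof.
move=> lF Ld; apply: xget_unique; first by exists L.
move=> d' [L' lF' Ld']; have := is_lift_unique lF lF'.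
rewrite Ld Ld' => /(@intr_inj R) e; lia.
Qed.

Lemma segment_star (x t : R) : `[0, 2 * pi]%classic x -> 0 <= t <= 1 ->
  `[0, 2 * pi]%classic (0 + t *: (x - 0)).
Proof.
rewrite /= !in_itv/= subr0 add0r => /andP[x0 x1] /andP[t0 t1].
rewrite mulr_ge0//= (le_trans _ x1)// ler_piMl//.
Qed.

Lemma windingP F : circle_loop F ->
  exists2 L, is_lift F L & L (2 * pi) - L 0 = (2 * winding F)%:~R.
Proof.
move=> [cF F2].
have [L cL LF] := circle_lift (@segment_compact _ _ _) segment_star cF.
have lL : is_lift F L by split=> // t tI; apply: LF; rewrite /= in_itv.
have /congr2P[d dE] : congr2 (L (2 * pi)) (L 0).
  apply: (congr2_trans (LF _ _)); first by rewrite /= in_itv/= lexx pi2_ge0.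
  by apply: congr2_trans F2 _; rewrite congr2_sym LF//= in_itv/= lexx.
by exists L => //; rewrite (windingE lL dE).
Qed.

Lemma eq_winding F G : (forall t, 0 <= t <= 2 * pi -> congr2 (F t) (G t)) ->
  circle_loop F -> winding F = winding G.
Proof.
move=> FG /windingP[L [cL lF] LE]; apply/esym/windingE; last exact: LE.
by split=> // t tI; apply: congr2_trans (lF _ tI) (FG _ tI).
Qed.

Lemma winding_periodic (L : R -> R) : {within `[0, 2 * pi]%classic, continuous L} ->
  L (2 * pi) = L 0 -> winding L = 0.
Proof.
move=> cL eL; apply: (@windingE _ L); last by rewrite eL subrr.
by split=> // t _; exact: congr2_refl.
Qed.

Lemma circle_loopD F G : circle_loop F -> circle_loop G ->
  circle_loop (fun t => F t + G t).
Proof.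
by move=> [cF pF] [cG pG]; split; [exact: circle_continuousD|exact: congr2D].
Qed.

Lemma circle_loopM (n : int) F : circle_loop F ->
  circle_loop (fun t => n%:~R * F t).
Proof.
by move=> [cF pF]; split; [exact: circle_continuousM|exact: congr2M].
Qed.

Lemma windingD F G : circle_loop F -> circle_loop G ->
  winding (fun t => F t + G t) = winding F + winding G.
Proof.
move=> /windingP[L [cL lF] LE] /windingP[M [cM lG] ME].
apply: (@windingE _ (fun t => L t + M t)).
  by split; [exact: withinD|move=> t tI; apply: congr2D; [exact: lF|exact: lG]].
by rewrite opprD addrACA LE ME -intrD mulrDr.
Qed.

Lemma windingM (n : int) F : circle_loop F ->
  winding (fun t => n%:~R * F t) = n * winding F.
Proof.
move=> /windingP[L [cL lF] LE]; apply: (@windingE _ (fun t => n%:~R * L t)).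
  split; first by apply: withinM => //; exact: within_cst.
  by move=> t tI; apply: congr2M; exact: lF.
by rewrite -mulrBr LE -intrM mulrCA.
Qed.

Lemma circle_loop_sum (I : Type) (r : seq I) (F : I -> R -> R) :
  (forall i, circle_loop (F i)) -> circle_loop (fun t => \sum_(i <- r) F i t).
Proof.
move=> cF; split; first by apply: circle_continuous_sum => i; case: (cF i).
by apply: congr2_sum => i; case: (cF i).
Qed.

(** The rectangle is star-shaped at (0, 0), so H lifts on all of it at once. The increment of the
    lift over [0, 2 pi] is continuous in s and an even integer, hence constant. *)
Lemma winding_homotopy (H : R * R -> R) :
  @circle_continuous _ (R * R)%type (`[0, 1]%classic `*` `[0, 2 * pi]%classic) H ->
  (forall s : R, 0 <= s <= 1 -> congr2 (H (s, 2 * pi)) (H (s, 0))) ->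
  winding (fun t => H (0, t)) = winding (fun t => H (1, t)).
Proof.
move=> cH pH; set K := _ `*` _ in cH.
have cK : compact K by apply: compact_setX; exact: segment_compact.
have sK : forall (x : R * R) t, K x -> 0 <= t <= 1 -> K ((0, 0) + t *: (x - (0, 0))).
  move=> [x y] t [] /=; rewrite !in_itv/= => /andP[x0 x1] yI tI; split=> /=.
    by case/andP: tI => t0 t1; rewrite in_itv/= subr0 add0r mulr_ge0//= mulr_ile1.
  exact: segment_star.
have [L cL LH] := circle_lift cK sK cH.
have KE s t : 0 <= s <= 1 -> 0 <= t <= 2 * pi -> K (s, t).
  by split; rewrite /= in_itv.
have cont_t s : 0 <= s <= 1 -> {within `[0, 2 * pi]%classic, continuous (fun t => L (s, t))}.
  move=> sI; apply: (within_continuous_comp (f := fun t => (s, t)) _ cL).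
    apply: continuous_subspaceT => t.
    by apply: (@cvg_pair _ _ _ (nbhs t) (nbhs s) (nbhs t)); [exact: cvg_cst|exact: cvg_id].
  by move=> t; rewrite /= in_itv/=; exact: KE.
have cont_s t : 0 <= t <= 2 * pi -> {within `[0, 1]%classic, continuous (fun s => L (s, t))}.
  move=> tI; apply: (within_continuous_comp (f := fun s => (s, t)) _ cL).
    apply: continuous_subspaceT => s.
    by apply: (@cvg_pair _ _ _ (nbhs s) (nbhs s) (nbhs t)); [exact: cvg_id|exact: cvg_cst].
  by move=> s; rewrite /= in_itv/= => sI; exact: KE.
have I0 : 0 <= (0 : R) <= 2 * pi by rewrite lexx pi2_ge0.
have I1 : 0 <= (2 * pi : R) <= 2 * pi by rewrite lexx pi2_ge0.
have J0 : 0 <= (0 : R) <= 1 by rewrite lexx ler01.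
have J1 : 0 <= (1 : R) <= 1 by rewrite lexx ler01.
have lL s : 0 <= s <= 1 -> is_lift (fun t => H (s, t)) (fun t => L (s, t)).
  by move=> sI; split; [exact: cont_t|move=> t tI; apply: LH; exact: KE].
have dL s : 0 <= s <= 1 -> congr2 (L (s, 2 * pi) - L (s, 0)) 0.
  move=> sI; rewrite -[X in congr2 _ X](subrr (H (s, 0))); apply: congr2B.
    exact: congr2_trans (LH _ (KE _ _ sI I1)) (pH _ sI).
  exact: LH (KE _ _ sI I0).
have E : L (1, 2 * pi) - L (1, 0) = L (0, 2 * pi) - L (0, 0).
  apply: (@within_constant_even _ 0 1 (fun s => L (s, 2 * pi) - L (s, 0))) => //.
    by apply: withinB; exact: cont_s.
  move=> s; rewrite in_itv/= => sI; apply: congr2_trans (dL _ sI) _.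
  by rewrite congr2_sym dL.
have /congr2P[d] := dL _ J0; rewrite subr0 => dE.
rewrite (windingE (lL _ J0) dE); rewrite -E in dE.
by rewrite (windingE (lL _ J1) dE).
Qed.
End Lifting.

(** * Winding numbers in the plane *)

Section Plane.
Context {R : realType}.

Lemma sqnorm_continuous k : continuous (@sqnorm R k).
Proof.
apply/continuous_subspace_setT; apply: within_sum => i.
apply: continuous_subspaceT => x.
apply: (@continuous_comp _ _ _ (fun y : 'rV[R]_k => y 0 i) (fun a => a ^+ 2)).
  exact: coord_continuous.
exact: exprn_continuous.
Qed.

Lemma sqnormZ k (a : R) (x : 'rV[R]_k) : sqnorm (a *: x) = a ^+ 2 * sqnorm x.
Proof. by rewrite /sqnorm mulr_sumr; apply: eq_bigr => i _; rewrite mxE exprMn. Qed.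

Lemma sqnorm_ge0 k (x : 'rV[R]_k) : 0 <= sqnorm x.
Proof. by apply: sumr_ge0 => i _; exact: sqr_ge0. Qed.

Lemma sqnorm_eq0 k (x : 'rV[R]_k) : (sqnorm x == 0) = (x == 0).
Proof.
apply/eqP/eqP => [/eqP|->]; last by rewrite /sqnorm big1// => i _; rewrite mxE expr0n.
rewrite psumr_eq0 => [/allP h|i _]; last exact: sqr_ge0.
apply/rowP => i; rewrite mxE; apply/eqP; rewrite -sqrf_eq0.
by apply: (implyP (h i _)) => //; exact: mem_index_enum.
Qed.

Lemma cball_closed k : closed (@cball R k).
Proof.
by apply: closed_comp (@closed_le R 1) => x _; exact: sqnorm_continuous.
Qed.

Lemma cball_compact k : compact (@cball R k).
Proof.
apply: bounded_closed_compact; last exact: cball_closed.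
exists 1; split; first exact: num_real.
move=> M M1 x /= x1; rewrite ltW//; apply: le_lt_trans M1.
rewrite [leLHS]/Num.norm/= mx_normrE; apply/bigmax_leP; split=> // -[i j] _ /=.
rewrite -(@expr_le1 _ 2)// real_normK ?num_real//; apply: le_trans x1.
by rewrite ord1 /sqnorm (bigD1 j)//= lerDl sumr_ge0// => l _; exact: sqr_ge0.
Qed.

Lemma cball_star k (x : 'rV[R]_k) (t : R) : cball x -> 0 <= t <= 1 ->
  cball (0 + t *: (x - 0)).
Proof.
rewrite /cball/= subr0 add0r sqnormZ => x1 /andP[t0 t1].
by rewrite mulr_ile1 ?sqnorm_ge0 ?exprn_ile1 ?exprn_ge0.
Qed.

Lemma oball_cball k : @oball R k `<=` @cball R k.
Proof. by move=> x /ltW. Qed.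

Lemma usphere_cball k : @usphere R k `<=` @cball R k.
Proof. by move=> x /= e; rewrite /cball/= (e : sqnorm x = 1). Qed.

Lemma cballE k (x : 'rV[R]_k) : cball x -> oball x \/ usphere x.
Proof.
by rewrite /cball/oball/usphere/= le_eqVlt => /orP[/eqP|]; [right|left].
Qed.

Lemma sqnorm2 (u : 'rV[R]_2) : sqnorm u = u 0 0 ^+ 2 + u 0 1 ^+ 2.
Proof.
rewrite /sqnorm big_ord_recr/= big_ord1.
by congr (u 0 _ ^+ _ + u 0 _ ^+ _); apply/val_inj.
Qed.

Lemma circle_ptE (t : R) : circle_pt t 0 0 = cos t /\ circle_pt t 0 1 = sin t.
Proof. by rewrite !mxE. Qed.

Lemma rV2P (u v : 'rV[R]_2) : u 0 0 = v 0 0 -> u 0 1 = v 0 1 -> u = v.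
Proof.
move=> e0 e1; apply/rowP => -[[|[|//]] i].
  by rewrite (_ : Ordinal i = 0)//; apply/val_inj.
by rewrite (_ : Ordinal i = 1)//; apply/val_inj.
Qed.

Lemma sqnorm_circle_pt (t : R) : sqnorm (circle_pt t) = 1.
Proof. by rewrite sqnorm2; have [-> ->] := circle_ptE t; exact: cos2Dsin2. Qed.

Lemma circle_pt_usphere (t : R) : usphere (circle_pt t).
Proof. exact: sqnorm_circle_pt. Qed.

Lemma circle_pt_cball (t : R) : cball (circle_pt t).
Proof. exact: usphere_cball (circle_pt_usphere t). Qed.

Lemma circle_pt_continuous : continuous (@circle_pt R).
Proof.
have -> : @circle_pt R = fun t => cos t *: circle_pt 0 + sin t *: circle_pt (pi / 2).
  apply/funext => t; have [e1 e2] := circle_ptE t; have [z1 z2] := @circle_ptE 0.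
  have [h1 h2] := circle_ptE (pi / 2); apply: rV2P; rewrite ?mxE/=.
    by rewrite cos0 cos_pihalf mulr1 mulr0 addr0.
  by rewrite sin0 sin_pihalf mulr1 mulr0 add0r.
move=> t; apply: cvgD; apply: cvgZl; [exact: continuous_cos|exact: continuous_sin].
Qed.

Lemma circle_pt2pi : circle_pt (2 * pi) = circle_pt 0 :> 'rV[R]_2.
Proof.
have E : 2 * pi = pi *+ 2 :> R by rewrite mulrC mulr_natr.
by apply: rV2P; rewrite !mxE/= E ?cos2pi ?cos0 ?sin2pi ?sin0.
Qed.

Lemma circle_ptDpi (t : R) : circle_pt (t + pi) = - circle_pt t.
Proof. by apply: rV2P; rewrite !mxE/= ?cosDpi ?sinDpi. Qed.

Lemma circle_pt_eq (a b : R) :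
  circle_pt (pi * a) = circle_pt (pi * b) -> congr2 a b.
Proof.
move=> e; apply: cos_sin_congr2.
  by have := congr1 (fun u : 'rV_2 => u 0 0) e; rewrite !mxE.
by have := congr1 (fun u : 'rV_2 => u 0 1) e; rewrite !mxE.
Qed.

Lemma congr2_circle_pt (a b : R) :
  congr2 a b -> circle_pt (pi * a) = circle_pt (pi * b).
Proof.
by move=> e; apply: rV2P; rewrite !mxE/= ?(congr2_cos e) ?(congr2_sin e).
Qed.

Lemma usphere_circle_pt (u : 'rV[R]_2) : usphere u ->
  exists2 t, 0 <= t < 2 * pi & u = circle_pt t.
Proof.
rewrite /usphere/= sqnorm2 => /unit_circle_angle[a [e0 e1]].
pose n := Num.floor (a / 2); pose b := a - (2 * n)%:~R.
have /andP[n1 n2] := floor_itv (a / 2).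
have b0 : 0 <= b.
  by rewrite subr_ge0 intrM mulrC -ler_pdivlMr ?ltr0n.
have b2 : b < 2.
  rewrite /b ltrBlDr intrM -[X in X + _]mulr1 -mulrDr mulrC.
  by rewrite -ltr_pdivrMr ?ltr0n// addrC -intrD1.
have pi0 := @pi_gt0 R.
exists (pi * b).
  by rewrite mulr_ge0 ?(ltW pi0)//= mulrC ltr_pM2r.
rewrite -(@congr2_circle_pt a b); first by apply: rV2P; rewrite !mxE.
by apply/congr2P; exists n; rewrite /b opprB addrC subrK.
Qed.

Lemma circle_pt_inj (s t : R) : 0 <= s < 2 * pi -> 0 <= t < 2 * pi ->
  circle_pt s = circle_pt t -> s = t.
Proof.
move=> /andP[s0 s1] /andP[t0 t1] e; have pi0 := @pi_gt0 R.
have E (x : R) : pi * (x / pi) = x by rewrite mulrCA divff ?mulr1 ?gt_eqF.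
have /congr2P[n] : congr2 (s / pi) (t / pi) by apply: circle_pt_eq; rewrite !E.
rewrite -mulrBl => /(canRL (divfK _)); rewrite gt_eqF// => /(_ isT) en.
have : n = 0.
  have n1 : (n%:~R : R) < 1.
    by rewrite -(ltr_pM2r (mulr_gt0 (ltr0n R 2) pi0)); move: en; rewrite intrM; nra.
  have n2 : (-1 : R) < n%:~R.
    by rewrite -(ltr_pM2r (mulr_gt0 (ltr0n R 2) pi0)); move: en; rewrite intrM; nra.
  by move: n1 n2; rewrite (ltr_int _ n 1) (ltr_int _ (-1) n); lia.
by move=> n0; rewrite n0 mulr0 mul0r in en; lra.
Qed.

(** The polar angle in units of pi. No branch is fixed: its properties are stated modulo 2, so its
    continuity away from 0 needs no cut. *)
Definition ang (u : 'rV[R]_2) : R :=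
  xget 0 [set a | u = Num.sqrt (sqnorm u) *: circle_pt (pi * a)].

Lemma angP (u : 'rV[R]_2) : u = Num.sqrt (sqnorm u) *: circle_pt (pi * ang u).
Proof.
apply: (@xgetPex _ 0 [set a | u = Num.sqrt (sqnorm u) *: circle_pt (pi * a)]).
have [->|u0] := eqVneq u 0.
  by exists 0; rewrite /= (eqP (_ : sqnorm 0 == 0)) ?sqnorm_eq0// sqrtr0 scale0r.
have s0 : 0 < sqnorm u by rewrite lt_def sqnorm_eq0 u0 sqnorm_ge0.
have r0 : Num.sqrt (sqnorm u) != 0 by rewrite gt_eqF// sqrtr_gt0.
pose v := (Num.sqrt (sqnorm u))^-1 *: u.
have : usphere v.
  by rewrite /usphere/= sqnormZ exprVn sqr_sqrtr ?ltW// mulVf// gt_eqF.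
rewrite /usphere/= sqnorm2 => /unit_circle_angle[a [e0 e1]].
exists a; rewrite /= -(_ : v = circle_pt (pi * a)); last by apply: rV2P; rewrite ?e0 ?e1 mxE.
by rewrite /v scalerA divff// scale1r.
Qed.

Lemma ang_scale (r a : R) : 0 < r -> congr2 (ang (r *: circle_pt (pi * a))) a.
Proof.
move=> r0; set u := r *: _; apply: circle_pt_eq.
have e := angP u; rewrite {2}/u sqnormZ sqnorm_circle_pt mulr1 sqrtr_sqr gtr0_norm// in e.
by apply: (scalerI (a := r)); rewrite ?gt_eqF// -e.
Qed.

Lemma angN (u : 'rV[R]_2) : u != 0 -> congr2 (ang (- u)) (ang u + 1).
Proof.
move=> u0; have -> : - u = Num.sqrt (sqnorm u) *: circle_pt (pi * (ang u + 1)).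
  by rewrite mulrDr mulr1 circle_ptDpi scalerN -angP.
by apply: ang_scale; rewrite sqrtr_gt0 lt_def sqnorm_eq0 u0 sqnorm_ge0.
Qed.

Lemma ang_circle_continuous (T : topologicalType) (A : set T) (f : T -> 'rV[R]_2) :
  {within A, continuous f} -> (forall x, A x -> f x != 0) ->
  circle_continuous A (ang \o f).
Proof.
move=> cf f0.
have cs : {within A, continuous (fun x => Num.sqrt (sqnorm (f x)))}.
  apply: (within_comp1 (f := fun x => sqnorm (f x)) (g := Num.sqrt)).
    apply: (within_continuous_comp (B := setT) cf _) => //.
    by apply: continuous_subspaceT; exact: sqnorm_continuous.
  exact: sqrt_continuous.
have s0 x : A x -> Num.sqrt (sqnorm (f x)) != 0.
  by move=> Ax; rewrite gt_eqF// sqrtr_gt0 lt_def sqnorm_eq0 f0//= sqnorm_ge0.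
have ci (i : 'I_2) : {within A, continuous (fun x => f x 0 i)}.
  apply: (within_continuous_comp (B := setT) (g := fun u : 'rV[R]_2 => u 0 i) cf _) => //.
  by apply: continuous_subspaceT; exact: coord_continuous.
have E x (i : 'I_2) : A x ->
    f x 0 i * (Num.sqrt (sqnorm (f x)))^-1 = circle_pt (pi * ang (f x)) 0 i.
  by move=> Ax; rewrite {1}(angP (f x)) mxE mulrAC (divff (s0 _ Ax)) mul1r.
split.
- apply: (eq_within_continuous _ (withinM (ci 0) (withinV cs s0))) => x Ax /=.
  by rewrite E// !mxE.
- apply: (eq_within_continuous _ (withinM (ci 1) (withinV cs s0))) => x Ax /=.
  by rewrite E// !mxE.
Qed.
End Plane.

(* Maps out of a compact space onto a Hausdorff one are quotient maps. *)
Lemma image_preimage_closed (S T U : topologicalType) (K : set S) (p : S -> T)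
    (F : T -> U) (C : set U) :
  compact K -> closed K -> hausdorff_space T ->
  {within K, continuous p} -> {within K, continuous (F \o p)} -> closed C ->
  closed ((p @` K) `&` F @^-1` C).
Proof.
move=> cK clK hT cp cF cC; have -> : (p @` K) `&` F @^-1` C =
    p @` (K `&` (F \o p) @^-1` C).
  apply/seteqP; split=> [_ [[x Kx <-] Cx]|_ [x [Kx Cx] <-]]; first by exists x.
  by split=> //; exists x.
apply: compact_closed => //; apply: continuous_compact.
  by apply: continuous_subspaceW cp => x [].
exact: within_compact_preimage.
Qed.

(** * Winding numbers and extensions on the closed disc *)

Section Disc.
Context {R : realType}.

Lemma loop_circle_pt (F : 'rV[R]_2 -> R) :
  circle_continuous (@usphere R 2) F -> circle_loop (F \o circle_pt).
Proof.
move=> cF; split; last by rewrite /= circle_pt2pi congr2_refl.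
apply: (circle_continuous_comp _ cF); last by move=> t _; exact: circle_pt_usphere.
by apply: continuous_subspaceT; exact: circle_pt_continuous.
Qed.

Lemma winding_disc0 (F : 'rV[R]_2 -> R) :
  circle_continuous (@cball R 2) F -> winding (F \o circle_pt) = 0.
Proof.
move=> cF; have [L cL LF] := circle_lift (@cball_compact _ _) (@cball_star _ _) cF.
have lL : is_lift (F \o circle_pt) (L \o circle_pt).
  split; last by move=> t _; apply: LF; exact: circle_pt_cball.
  apply: (within_continuous_comp _ cL); last by move=> t _; exact: circle_pt_cball.
  by apply: continuous_subspaceT; exact: circle_pt_continuous.
by apply: (windingE lL); rewrite /= circle_pt2pi subrr mulr0.
Qed.

(* The lift of an odd map changes by the same odd integer over each half turn. *)
Lemma winding_odd (F : R -> R) : circle_loop F ->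
  (forall t, 0 <= t <= pi -> congr2 (F (t + pi)) (F t + 1)) ->
  exists m : int, winding F = 2 * m + 1.
Proof.
move=> lF oF; have [L [cL LF] LE] := windingP lF.
have pi0 : 0 <= pi :> R by exact: pi_ge0.
have I (t : R) : 0 <= t <= pi -> (0 <= t <= 2 * pi) && (0 <= t + pi <= 2 * pi).
  by move=> /andP[t0 t1]; apply/andP; split; apply/andP; split; lra.
have dL (t : R) : 0 <= t <= pi -> congr2 (L (t + pi) - L t) 1.
  move=> tI; have /andP[I1 I2] := I _ tI.
  apply: congr2_trans (congr2B (LF _ I2) (LF _ I1)) _.
  rewrite -[X in congr2 _ X](addrK (F t)) [1 + _]addrC.
  exact: congr2B (oF _ tI) (congr2_refl _).
have E : L (pi + pi) - L pi = L (0 + pi) - L 0.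
  apply: (@within_constant_even _ 0 pi (fun t => L (t + pi) - L t)) => //.
    apply: withinB.
      apply: (within_continuous_comp (f := fun t : R => t + pi) _ cL).
        by apply: continuous_subspaceT => t; apply: cvgD; [exact: cvg_id|exact: cvg_cst].
      by move=> t; rewrite /= !in_itv/= => /I/andP[].
    by apply: continuous_subspaceW cL => t; rewrite /= !in_itv/= => /I/andP[].
  move=> t; rewrite in_itv/= => tI; apply: congr2_trans (dL _ tI) _.
  by rewrite congr2_sym dL// lexx.
have /dL/congr2P[m mE] : 0 <= (0 : R) <= pi by rewrite lexx.
exists m; apply: (@intr_inj R); apply: (@mulfI _ 2) => //.
rewrite -[2 in LHS]/(2%:~R) -intrM -LE.
rewrite (_ : 2 * pi = pi + pi); last by rewrite mulrDl mul1r.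
rewrite intrD intrM; rewrite intrM in mE; rewrite add0r in mE E.
by lra.
Qed.

(** Injectivity is asked on the open disc only, with the circle kept apart from it, since a
    characteristic map may identify points of the circle. *)
Lemma winding_injective_disc (g : 'rV[R]_2 -> 'rV[R]_2) :
  {within @cball R 2, continuous g} -> {in @oball R 2 &, injective g} ->
  (forall u v, usphere u -> oball v -> g u != g v) ->
  exists m : int, winding (fun t => ang (g (circle_pt t) - g 0)) = 2 * m + 1.
Proof.
move=> cg ig sg.
have o0 : oball (0 : 'rV[R]_2).
  by rewrite /oball/= (eqP (_ : sqnorm 0 == 0)) ?sqnorm_eq0.
(* For a point u of the circle the pair (u, 0) slides to (u/2, -u/2). The two points always differ
   by u, hence are distinct, and the second stays in the open disc; at the end of the homotopy, u ->
   -u exchanges them. *)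
pose a (x : R * R) : 'rV[R]_2 := (1 - x.1 / 2) *: circle_pt x.2.
pose b (x : R * R) : 'rV[R]_2 := - (x.1 / 2) *: circle_pt x.2.
pose H x := ang (g (a x) - g (b x)).
pose K : set (R * R) := `[0, 1]%classic `*` `[0, 2 * pi]%classic.
have KE (s t : R) : K (s, t) -> 0 <= s <= 1 by case; rewrite /= !in_itv.
have c2 : continuous (fun x : R * R => circle_pt x.2).
  move=> x; apply: (@continuous_comp _ _ _ snd circle_pt); first exact: cvg_snd.
  exact: circle_pt_continuous.
have c1 : continuous (fun x : R * R => x.1 / 2).
  by move=> x; apply: cvgMl; exact: cvg_fst.
have ca : continuous a.
  move=> x; apply: cvgZ; last exact: c2.
  by apply: cvgB; [exact: cvg_cst|exact: c1].
have cb : continuous b.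
  by move=> x; apply: cvgZ; [apply: cvgN; exact: c1|exact: c2].
have Ka x : K x -> cball (a x).
  case: x => s t /KE /andP[s0 s1]; rewrite /cball/= sqnormZ sqnorm_circle_pt mulr1/=.
  by rewrite exprn_ile1//; lra.
have Kb x : K x -> oball (b x).
  case: x => s t /KE /andP[s0 s1]; rewrite /oball/= sqnormZ sqnorm_circle_pt mulr1/=.
  by rewrite sqrrN exprn_ilt1//; lra.
have ab x : a x != b x.
  rewrite -subr_eq0 -scalerBl opprK subrK scale1r.
  apply: contraTneq isT => c0; have := sqnorm_circle_pt x.2.
  by move/eqP; rewrite c0 (eqP (_ : sqnorm 0 == 0)) ?sqnorm_eq0// eq_sym oner_eq0.
have gab x : K x -> g (a x) - g (b x) != 0.
  move=> Kx; rewrite subr_eq0; have [oa|sa] := cballE (Ka _ Kx).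
    by apply: contraNneq (ab x) => /ig ->//; rewrite inE//; exact: Kb.
  by apply: sg => //; exact: Kb.
have cH : circle_continuous K H.
  apply: (ang_circle_continuous (f := fun x => g (a x) - g (b x))) => //.
  have h1 : {within K, continuous (g \o a)}.
    by apply: (within_continuous_comp _ cg) => //; exact: continuous_subspaceT.
  have h2 : {within K, continuous (g \o b)}.
    apply: (within_continuous_comp _ cg); first exact: continuous_subspaceT.
    by move=> x /Kb; exact: oball_cball.
  by move=> x; apply: cvgB; [exact: h1|exact: h2].
have pH (s : R) : 0 <= s <= 1 -> congr2 (H (s, 2 * pi)) (H (s, 0)).
  by move=> _; rewrite /H /a /b /= circle_pt2pi congr2_refl.
have E := winding_homotopy cH pH.
have E0 : (fun t => H (0, t)) = fun t => ang (g (circle_pt t) - g 0).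
  by apply/funext => t; rewrite /H /a /b/= mul0r subr0 scale1r oppr0 scale0r.
rewrite -E0 E; apply: winding_odd.
  split; last by apply: pH; rewrite lexx ler01.
  apply: (circle_continuous_comp (f := fun t : R => (1 : R, t)) _ cH).
    apply: continuous_subspaceT => t.
    by apply: (@cvg_pair _ _ _ (nbhs t) (nbhs (1 : R)) (nbhs t)); [exact: cvg_cst|exact: cvg_id].
  by move=> t; rewrite /= => tI; split=> //; rewrite /= in_itv/= lexx ler01.
move=> t tI; have Kt : K (1, t).
  have pi0 := @pi_ge0 R.
  by split; rewrite /= in_itv/= ?lexx ?ler01//; move: tI => /andP[t0 t1]; apply/andP; split; lra.
rewrite /H (_ : g (a (1, t + pi)) - g (b (1, t + pi)) = - (g (a (1, t)) - g (b (1, t)))).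
  exact/angN/gab.
have e : 1 - 1 / 2 = 1 / 2 :> R by lra.
by rewrite /a /b/= circle_ptDpi e !scalerN !scaleNr !opprK opprB.
Qed.

(** Sliding p to the center along its radius keeps it off the circle; about the center t / pi is a
    lift. *)
Lemma winding_about_interior (p : 'rV[R]_2) : oball p ->
  winding (fun t => ang (circle_pt t - p)) = 1.
Proof.
move=> op; pose H (x : R * R) := ang (circle_pt x.2 - (1 - x.1) *: p).
have pi0 := @pi_gt0 R.
have cH : @circle_continuous _ (R * R)%type (`[0, 1]%classic `*` `[0, 2 * pi]%classic) H.
  apply: (ang_circle_continuous (f := fun x : R * R => circle_pt x.2 - (1 - x.1) *: p)).
    apply: continuous_subspaceT => x; apply: cvgB.
      apply: (@continuous_comp _ _ _ snd circle_pt); first exact: cvg_snd.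
      exact: circle_pt_continuous.
    by apply: cvgZl; apply: cvgB; [exact: cvg_cst|exact: cvg_fst].
  move=> [s t] [] /=; rewrite in_itv/= => /andP[s0 s1] _; rewrite subr_eq0.
  apply: contraTneq isT => e; have := sqnorm_circle_pt t; rewrite e sqnormZ => E.
  have : (1 - s) ^+ 2 * sqnorm p < 1.
    rewrite (le_lt_trans _ (op : sqnorm p < 1))// ler_piMl ?sqnorm_ge0//.
    by rewrite exprn_ile1//; lra.
  by rewrite E ltxx.
have E : winding (fun t => H (0, t)) = winding (fun t => H (1, t)).
  apply: (winding_homotopy cH) => s _.
  by rewrite /H/= circle_pt2pi congr2_refl.
rewrite (_ : (fun t => _) = fun t => H (0, t)); last first.
  by apply/funext => t; rewrite /H/= subr0 scale1r.
rewrite E; apply: (@windingE _ _ (fun t => t / pi)).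
  split; first by apply: continuous_subspaceT => t; apply: cvgMl; exact: cvg_id.
  move=> t _; rewrite /H/= subrr scale0r subr0 congr2_sym.
  have -> : circle_pt t = 1 *: circle_pt (pi * (t / pi)) :> 'rV[R]_2.
    by rewrite scale1r mulrCA divff ?mulr1 ?gt_eqF.
  exact: ang_scale.
by rewrite mul0r subr0 mulfK ?gt_eqF// mulr1.
Qed.

(** Radial extension: the value at radius r and angle t is r L(t). Continuity holds because polar
    coordinates map a compact rectangle onto the disc, hence as a quotient map. This turns a
    vanishing winding number into an extension over a face. *)
Lemma cone_extension (L : R -> R) :
  {within `[0, 2 * pi]%classic, continuous L} -> L (2 * pi) = L 0 ->
  exists2 M : 'rV[R]_2 -> R, {within @cball R 2, continuous M} &
    forall t, 0 <= t <= 2 * pi -> M (circle_pt t) = L t.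
Proof.
move=> cL L0; pose K : set (R * R) := `[0, 1]%classic `*` `[0, 2 * pi]%classic.
pose p (x : R * R) : 'rV[R]_2 := x.1 *: circle_pt x.2.
have KE (s t : R) : K (s, t) <-> (0 <= s <= 1) /\ (0 <= t <= 2 * pi).
  by split; case; rewrite /= ?in_itv.
have pi0 := @pi_gt0 R.
(* Polar coordinates are ambiguous only at radius 0, where the factor [x.1] vanishes, and between
   the angles 0 and 2 pi, where L agrees. *)
have wd x y : K x -> K y -> p x = p y -> x.1 * L x.2 = y.1 * L y.2.
  case: x y => [s t] [s' t'] /KE[/andP[s0 _] tI] /KE[/andP[s0' _] tI']; rewrite /p/= => e.
  have es : s = s'.
    have := congr1 (@sqnorm R 2) e; rewrite !sqnormZ !sqnorm_circle_pt !mulr1.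
    by move/eqP; rewrite eqrXn2// => /eqP.
  rewrite -es in e *; have [->|sn0] := eqVneq s 0; first by rewrite !mul0r.
  congr (s * _); have et := scalerI sn0 e.
  have norm (r : R) : 0 <= r <= 2 * pi -> exists2 q : R, 0 <= q < 2 * pi &
      circle_pt q = circle_pt r /\ L q = L r.
    move=> /andP[r0]; rewrite le_eqVlt => /orP[/eqP ->|r1].
      by exists 0; rewrite ?circle_pt2pi ?lexx ?mulr_gt0.
    by exists r; rewrite ?r0.
  have [q qI [qt <-]] := norm _ tI; have [q' qI' [qt' <-]] := norm _ tI'.
  by congr (L _); apply: circle_pt_inj => //; rewrite qt qt'.
have pK u : cball u -> exists2 x, K x & p x = u.
  rewrite /cball/= => u1; set r := Num.sqrt (sqnorm u).
  have [t tI tE] := usphere_circle_pt (circle_pt_usphere (pi * ang u)).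
  exists (r, t); last by rewrite /p/= -tE [RHS]angP.
  apply/KE; case/andP: tI => t0 t1; split; last by rewrite t0 ltW.
  by rewrite /r sqrtr_ge0/= -[leRHS]sqrtr1 ler_sqrt ?ler01.
pose M (u : 'rV[R]_2) := let x := xget (0, 0) [set x | K x /\ p x = u] in x.1 * L x.2.
have ME x : K x -> M (p x) = x.1 * L x.2.
  move=> Kx; rewrite /M; case: xgetP => [y _ [Ky e]|/(_ x)/not_andP[]//].
  exact: wd.
have cp : continuous p.
  move=> x; apply: cvgZ; first exact: cvg_fst.
  apply: (@continuous_comp _ _ _ snd circle_pt); first exact: cvg_snd.
  exact: circle_pt_continuous.
have cK : compact K by apply: compact_setX; exact: segment_compact.
have hRR : hausdorff_space (R * R)%type by exact: norm_hausdorff.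
exists M.
  apply: closed_within_continuous => C cC.
  have -> : cball (k := 2) = p @` K.
    apply/seteqP; split=> [u /pK[x Kx <-]|_ [[s t] /KE[/andP[s0 s1] _] <-]]; first by exists x.
    by rewrite /cball/= /p/= sqnormZ sqnorm_circle_pt mulr1 exprn_ile1.
  apply: image_preimage_closed => //.
  - exact: compact_closed.
  - exact: continuous_subspaceT.
  - refine (@eq_within_continuous (R * R)%type R _ (fun x => x.1 * L x.2) _ _ _).
      by move=> x Kx; rewrite /= ME.
    apply: withinM; first by apply: continuous_subspaceT => x; exact: cvg_fst.
    apply: (within_continuous_comp (f := snd) _ cL); last by move=> x [].
    by apply: continuous_subspaceT => x; exact: cvg_snd.
move=> t tI; have Kt : K (1, t) by apply/KE; rewrite lexx ler01.
by rewrite -[circle_pt t]scale1r -[RHS]mul1r -(ME _ Kt).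
Qed.
End Disc.

(** * Circle maps on graphs *)

Section Cells.
Context {R : realType} {X : cellComplex2 R}.

Lemma open_cell_inj k (s : cell X k) l (t : cell X l) x :
  open_cell s x -> open_cell t x -> existT (cell X) k s = existT (cell X) l t.
Proof. by move=> sx tx; apply: cell_disjoint; exists x. Qed.

Lemma open_cell_dim k (s : cell X k) l (t : cell X l) x :
  open_cell s x -> open_cell t x -> k = l.
Proof. by move=> sx tx; exact: (congr1 (@projT1 _ _) (open_cell_inj sx tx)). Qed.

Lemma open_cell_eq k (s t : cell X k) x : open_cell s x -> open_cell t x -> s = t.
Proof.
move=> sx tx; have := projT2_eq (open_cell_inj sx tx).
by move: (projT1_eq _) => /= ek; rewrite (eq_irrelevance ek erefl).
Qed.

Lemma char_open_cell k (s : cell X k) u : oball u -> open_cell s (char s u).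
Proof. by move=> ou; exists u. Qed.

Lemma union_cells_open (Y : subcomplex X) k (s : cell X k) x :
  union_cells Y x -> open_cell s x -> Y k s.
Proof.
move=> [l [t [Yt tx]]] sx.
by have el := open_cell_dim tx sx; subst l; rewrite -(open_cell_eq tx sx).
Qed.

Lemma char_union_cells (Y : subcomplex X) k (s : cell X k) u :
  Y k s -> cball u -> union_cells Y (char s u).
Proof. by move=> Ys cu; apply: subcells_closed Ys _ _; exists u. Qed.

Lemma coordinates_exist (x : X) :
  exists p : {k & (cell X k * 'rV[R]_k)%type},
    oball (projT2 p).2 /\ char (projT2 p).1 (projT2 p).2 = x.
Proof.
by have [k [s [u ou <-]]] := cell_cover x; exists (existT _ k (s, u)).
Qed.

(** Every point has unique coordinates in a unique open cell, so a function on X may be prescribed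
    cell by cell with no compatibility condition; continuity is checked afterwards on closed
    cells. *)
Definition cell_map (V : Type) (phi : forall k, cell X k -> 'rV[R]_k -> V) (x : X) : V :=
  let p := projT2 (projT1 (cid (coordinates_exist x))) in phi _ p.1 p.2.

Lemma cell_mapE V (phi : forall k, cell X k -> 'rV[R]_k -> V) k (s : cell X k) u :
  oball u -> cell_map phi (char s u) = phi k s u.
Proof.
move=> ou; rewrite /cell_map; case: cid => -[l [t v]] /= [ov e].
have tx : open_cell t (char s u) by exists v.
have el := open_cell_dim tx (char_open_cell s ou); subst l.
have et := open_cell_eq tx (char_open_cell s ou); subst t.
by congr phi; apply: (@char_inj _ _ _ s) => //; rewrite inE.
Qed.

Definition by_dim (p0 : cell X 0 -> R) (p1 : cell X 1 -> R -> R)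
    (p2 : cell X 2 -> 'rV[R]_2 -> R) k : cell X k -> 'rV[R]_k -> R :=
  match k with
  | 0 => fun s _ => p0 s
  | 1 => fun s u => p1 s (u 0 0)
  | 2 => p2
  | _ => fun _ _ => 0
  end.

Definition vertex_pt (v : cell X 0) : X := char v 0.

Definition edge_path (e : cell X 1) (s : R) : X := char e (const_mx s).

Lemma rV1E (u : 'rV[R]_1) : u = const_mx (u 0 0).
Proof. by apply/rowP => i; rewrite mxE ord1. Qed.

Lemma sqnorm_const1 (s : R) : sqnorm (const_mx s : 'rV[R]_1) = s ^+ 2.
Proof. by rewrite /sqnorm big_ord1 mxE. Qed.

Lemma oball1 (s : R) : oball (const_mx s : 'rV[R]_1) <-> -1 < s < 1.
Proof. by rewrite /oball/= sqnorm_const1 -ltr_norml -real_normK ?num_real// expr_lt1. Qed.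

Lemma cball1 (s : R) : cball (const_mx s : 'rV[R]_1) <-> -1 <= s <= 1.
Proof. by rewrite /cball/= sqnorm_const1 -ler_norml -real_normK ?num_real// expr_le1. Qed.

Lemma usphere1 (s : R) : s ^+ 2 = 1 -> usphere (const_mx s : 'rV[R]_1).
Proof. by rewrite /usphere/= sqnorm_const1. Qed.

Lemma oball0 (u : 'rV[R]_0) : oball u.
Proof. by rewrite /oball/= /sqnorm big_ord0. Qed.

Lemma open_vertex (v : cell X 0) x : open_cell v x <-> x = vertex_pt v.
Proof.
split=> [[u _ <-]|->]; last by exists 0 => //; exact: oball0.
by rewrite /vertex_pt (_ : u = 0)//; apply/rowP => -[].
Qed.

Lemma edge_end_vertex (e : cell X 1) (s : R) : s ^+ 2 = 1 ->
  exists v : cell X 0, edge_path e s = vertex_pt v.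
Proof.
move=> s1; have [l [v [lt_l1 vx]]] := @char_boundary _ X _ e _ (usphere1 s1).
case: l lt_l1 v vx => // _ v vx.
by exists v; apply/open_vertex.
Qed.

Definition edge_head e : cell X 0 := projT1 (cid (@edge_end_vertex e 1 (expr1n _ _))).

Definition edge_tail e : cell X 0 := projT1 (cid (@edge_end_vertex e (-1) (sqrr_sign _ 1))).

Lemma edge_headE e : edge_path e 1 = vertex_pt (edge_head e).
Proof. by rewrite /edge_head; case: cid. Qed.

Lemma edge_tailE e : edge_path e (-1) = vertex_pt (edge_tail e).
Proof. by rewrite /edge_tail; case: cid. Qed.

(* The collapse of the complement of the open edge [e] to the class of 1 in R/2Z. *)
Definition collapse (e : cell X 1) (x : X) : R :=
  xget 1 [set s | -1 < s < 1 /\ x = edge_path e s].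

Lemma collapse_in e s : -1 < s < 1 -> collapse e (edge_path e s) = s.
Proof.
move=> sI; rewrite /collapse; case: xgetP => [y _ [yI e1]|/(_ s)/not_andP[]//].
have := @char_inj _ _ _ e (const_mx s) (const_mx y); rewrite !inE.
by move=> /(_ (proj2 (oball1 _) sI) (proj2 (oball1 _) yI) e1)/rowP/(_ 0); rewrite !mxE.
Qed.

Lemma collapse_out e x : ~ open_cell e x -> collapse e x = 1.
Proof.
move=> ex; rewrite /collapse; apply: xgetPN => s [sI E]; apply: ex; rewrite E.
by apply: char_open_cell; exact/oball1.
Qed.

Lemma open_edgeP e x : open_cell e x -> exists2 s, -1 < s < 1 & x = edge_path e s.
Proof.
by move=> [u ou <-]; rewrite (rV1E u) in ou *; exists (u 0 0) => //; exact/oball1.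
Qed.

Lemma vertex_notin_edge (e : cell X 1) v : ~ open_cell e (vertex_pt v).
Proof. by move=> ev; have := open_cell_dim ev (proj2 (open_vertex v _) erefl). Qed.

Lemma collapse_vertex e v : collapse e (vertex_pt v) = 1.
Proof. exact/collapse_out/vertex_notin_edge. Qed.

Lemma edge_path_endpoint (s : R) : -1 <= s <= 1 ->
  [\/ -1 < s < 1, s = 1 | s = -1].
Proof.
move=> /andP[]; rewrite !le_eqVlt => /orP[/eqP <-|s0]; first by constructor 3.
by case/orP=> [/eqP ->|s1]; [constructor 2|constructor 1; rewrite s0].
Qed.

Lemma collapse_liftE f e g :
  collapse_lift f e g <-> is_lift (collapse e \o attaching_loop f) g.
Proof.
split=> -[cg lg]; split=> // t tI.
  have [n [[s1 le]|[s1 le]]] := lg t tI.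
    rewrite /= le -/(edge_path e _) collapse_in; last by rewrite -ltr_norml.
    by apply/congr2P; exists n; rewrite opprB addrC subrK.
  rewrite /= collapse_out//; apply/congr2P; exists n.
  by rewrite -[X in _ - X]s1 opprB addrC subrK.
have /congr2P[n gE] := lg t tI; exists n.
have -> : g t - (2 * n)%:~R = (collapse e \o attaching_loop f) t.
  by rewrite -gE opprB addrC subrK.
have [/open_edgeP[s sI le]|ex] := pselect (open_cell e (attaching_loop f t)).
  by left; rewrite /= le collapse_in// ltr_norml.
by right; rewrite /= collapse_out.
Qed.

Lemma attaching_degreeE f e :
  attaching_degree f e = winding (collapse e \o attaching_loop f).
Proof.
rewrite /attaching_degree /winding; congr xget; apply/seteqP.
by split=> d [g lg gd]; exists g => //; apply/collapse_liftE.
Qed.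

(** Each closed cell has the quotient topology of its ball by [image_preimage_closed], and the
    preimage of a closed set is a finite union of closed pieces, one per cell of Y. *)
Lemma paste_cells (Y : subcomplex X) (T : topologicalType) (F : X -> T) :
  (forall k, finite_set (Y k)) ->
  (forall k (s : cell X k), Y k s -> {within @cball R k, continuous (F \o char s)}) ->
  {within union_cells Y, continuous F}.
Proof.
move=> finY cF; apply: closed_within_continuous => C cC.
have -> : union_cells Y `&` F @^-1` C =
    \bigcup_(k in `I_3) \bigcup_(s in Y k) ((char s @` @cball R k) `&` F @^-1` C).
  apply/seteqP; split=> [x [[k [s [Ys sx]]] Cx]|x [k _ [s Ys [[u cu <-] Cx]]]].
    exists k; first by rewrite /= ltnS; exact: cell_dim s.
    by exists s => //; split=> //; case: sx => u ou <-; exists u => //; exact: oball_cball.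
  by split=> //; exact: char_union_cells.
apply: closed_bigcup => [|k _]; first exact: finite_II.
apply: closed_bigcup => // s Ys; apply: image_preimage_closed => //.
- exact: cball_compact.
- exact: cball_closed.
- exact: space_hausdorff.
- exact: char_continuous.
- exact: cF.
Qed.

Lemma edge_path_continuous e : {within `[-1, 1]%classic, continuous (edge_path e)}.
Proof.
apply: (within_continuous_comp (f := fun s : R => const_mx s : 'rV[R]_1) _
  (@char_continuous _ _ _ e)).
  apply: continuous_subspaceT => s.
  have -> : (fun s : R => const_mx s : 'rV[R]_1) = fun s => s *: const_mx 1.
    by apply/funext => a; apply/rowP => i; rewrite !mxE mulr1.
  by apply: cvgZl; exact: cvg_id.
by move=> s; rewrite /= in_itv/= => sI; exact/cball1.
Qed.

(** * Circle maps on a finite graph, to be applied both to the 1-skeleton of a disc and to its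
    boundary *)

Section Graph.
Variable Y : subcomplex X.
Hypotheses (finY : forall k, finite_set (Y k)) (graphY : is_subgraph Y).

Lemma paste_edges (T : topologicalType) (F : X -> T) :
  (forall e, Y 1 e -> {within `[-1, 1]%classic, continuous (F \o edge_path e)}) ->
  {within union_cells Y, continuous F}.
Proof.
move=> cF; apply: paste_cells => // -[|[|k]] s Ys.
- apply: (@eq_within_continuous _ _ _ (fun=> F (vertex_pt s))).
    by move=> u _; rewrite /= /vertex_pt (_ : u = 0)//; apply/rowP => -[].
  by apply: continuous_subspaceT; exact: cst_continuous.
- apply: (@eq_within_continuous _ _ _ ((F \o edge_path s) \o (fun u : 'rV[R]_1 => u 0 0))).
    by move=> u _; rewrite /= /edge_path -rV1E.
  apply: (within_continuous_comp _ (cF _ Ys)).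
    by apply: continuous_subspaceT; exact: coord_continuous.
  by move=> u; rewrite (rV1E u) => /cball1; rewrite /= in_itv/= mxE.
- by have := graphY (isT : (1 < k.+2)%N) => Yk; move: Ys; rewrite Yk.
Qed.

Lemma paste_edges_circle (F : X -> R) :
  (forall e, Y 1 e -> circle_continuous (`[-1, 1]%classic : set R) (F \o edge_path e)) ->
  circle_continuous (union_cells Y) F.
Proof. by move=> cF; split; apply: paste_edges => e /cF[]. Qed.

Lemma edge_path_union e s : Y 1 e -> -1 <= s <= 1 -> union_cells Y (edge_path e s).
Proof. by move=> Ye sI; apply: char_union_cells => //; exact/cball1. Qed.

Lemma collapse_other e e' s : -1 <= s <= 1 -> e' != e -> collapse e (edge_path e' s) = 1.
Proof.
move=> /edge_path_endpoint[sI|->|->] ee'.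
- apply: collapse_out => ex; move/eqP: ee'; apply; apply: (open_cell_eq _ ex).
  by apply: char_open_cell; exact/oball1.
- by rewrite edge_headE collapse_vertex.
- by rewrite edge_tailE collapse_vertex.
Qed.

Lemma collapse_same e s : -1 <= s <= 1 -> congr2 (collapse e (edge_path e s)) s.
Proof.
move=> /edge_path_endpoint[sI|->|->]; first by rewrite collapse_in ?congr2_refl.
  by rewrite edge_headE collapse_vertex congr2_refl.
by rewrite edge_tailE collapse_vertex; apply/congr2P; exists 1; rewrite mulr1 opprK.
Qed.

Lemma collapse_continuous e : circle_continuous (union_cells Y) (collapse e).
Proof.
apply: paste_edges_circle => e' _; have [->|ee'] := eqVneq e' e.
  apply: (@eq_circle_continuous _ _ _ (fun s => s)).
    by move=> s; rewrite /= in_itv/= congr2_sym; exact: collapse_same.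
  by apply: within_circle_continuous; apply: continuous_subspaceT => s; exact: cvg_id.
apply: (@eq_circle_continuous _ _ _ (fun=> 1)).
  by move=> s; rewrite /= in_itv/= => sI; rewrite collapse_other ?congr2_refl.
exact/within_circle_continuous/within_cst.
Qed.

Local Notation E := (enum_fset (fset_set (Y 1))).

(* The circle-valued map that runs [w e] times around R/2Z along the edge [e]. *)
Definition winding_map (w : cell X 1 -> int) (x : X) : R :=
  \sum_(e <- E) (w e)%:~R * (collapse e x + 1).

(** This explains the shift by 1 in [winding_map]: vertices collapse to 1, and integral multiples of
    1 + 1 vanish in R/2Z, so all vertices go to the base point. *)
Lemma winding_map_vertex w v : congr2 (winding_map w (vertex_pt v)) 0.
Proof.
rewrite /winding_map [X in congr2 _ X](_ : 0 = \sum_(e <- E) (0 : R)); last by rewrite big1.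
apply: congr2_sum => e; rewrite collapse_vertex.
by apply/congr2P; exists (w e); rewrite subr0 mulrC intrM.
Qed.

Lemma winding_map_edge w e s : Y 1 e -> -1 <= s <= 1 ->
  congr2 (winding_map w (edge_path e s)) ((w e)%:~R * (s + 1)).
Proof.
move=> Ye sI; rewrite /winding_map.
have eE : e \in E by rewrite in_fset_set// inE.
have -> : (w e)%:~R * (s + 1) =
    \sum_(e' <- E) (if e' == e then (w e)%:~R * (s + 1) else 0) :> R.
  by rewrite (bigD1_seq e eE (fset_uniq _))/= eqxx big1 ?addr0// => i /negbTE ->.
apply: congr2_sum => e'; case: eqVneq => [->|ee'].
  by apply: congr2M; apply: congr2D (congr2_refl _); exact: collapse_same.
rewrite collapse_other 1?eq_sym//.
by apply/congr2P; exists (w e'); rewrite subr0 mulrC intrM.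
Qed.

Lemma graph_ind (P : X -> Prop) : (forall v, P (vertex_pt v)) ->
  (forall e s, Y 1 e -> -1 <= s <= 1 -> P (edge_path e s)) ->
  forall x, union_cells Y x -> P x.
Proof.
move=> P0 P1 x [[|[|k]] [s [Ys sx]]].
- by move/open_vertex: sx => ->.
- by have [r /andP[r0 r1] ->] := open_edgeP sx; apply: P1; rewrite ?ltW.
- by have := graphY (isT : (1 < k.+2)%N) => Yk; move: Ys; rewrite Yk.
Qed.

Lemma winding_map_continuous w : circle_continuous (union_cells Y) (winding_map w).
Proof.
apply: circle_continuous_sum => e; apply: circle_continuousM.
apply: circle_continuousD (@collapse_continuous e) _.
exact/within_circle_continuous/within_cst.
Qed.

Lemma winding_map_loop w (c : R -> X) :
  {within `[0, 2 * pi]%classic, continuous c} ->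
  (forall t, 0 <= t <= 2 * pi -> union_cells Y (c t)) -> c (2 * pi) = c 0 ->
  winding (winding_map w \o c) = \sum_(e <- E) w e * winding (collapse e \o c).
Proof.
move=> cc cY c0; have lc e : circle_loop (collapse e \o c).
  split; last by rewrite /= c0 congr2_refl.
  by apply: (circle_continuous_comp cc (@collapse_continuous e)) => t /=; rewrite in_itv; exact: cY.
have l1 : circle_loop (fun=> 1 : R).
  by split; [exact/within_circle_continuous/within_cst|exact: congr2_refl].
have lc1 e := circle_loopD (lc e) l1.
have w1 : winding (fun=> 1 : R) = 0 by apply: winding_periodic => //; exact: within_cst.
rewrite /winding_map; elim: (E : seq _) => [|e r IH].
  rewrite big_nil (_ : _ \o _ = fun=> 0); last by apply/funext => t; rewrite /= big_nil.
  by apply: winding_periodic => //; exact: within_cst.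
rewrite big_cons -IH -[winding (collapse e \o c)]addr0 -w1 -windingD//.
rewrite -windingM// -windingD//.
- by congr winding; apply/funext => t; rewrite /= big_cons.
- exact: circle_loopM.
- by apply: circle_loop_sum => e'; apply: circle_loopM; exact: lc1.
Qed.

Definition edge_coboundary (v : cell X 0 -> int) (e : cell X 1) : int :=
  v (edge_head e) - v (edge_tail e).

Lemma cell_map_vertex phi v : cell_map phi (vertex_pt v) = phi 0 v 0 :> R.
Proof. by rewrite /vertex_pt cell_mapE//; exact: oball0. Qed.

Lemma cell_map_edge p0 p1 p2 e s : -1 < s < 1 ->
  cell_map (by_dim p0 p1 p2) (edge_path e s) = p1 e s.
Proof. by move=> sI; rewrite /edge_path cell_mapE /= ?mxE//; exact/oball1. Qed.

(* The linear interpolation of [v] along the edges lifts [winding_map]. *)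
Lemma winding_map_coboundary v : exists2 r : X -> R,
  {within union_cells Y, continuous r} &
  forall x, union_cells Y x -> congr2 (winding_map (edge_coboundary v) x) (r x).
Proof.
pose p1 e s : R := (2 * v (edge_tail e))%:~R + (edge_coboundary v e)%:~R * (s + 1).
pose r : X -> R := cell_map (by_dim (fun u => (2 * v u)%:~R) p1 (fun _ _ => 0)).
have rE e s : -1 <= s <= 1 -> r (edge_path e s) = p1 e s.
  move=> /edge_path_endpoint[sI|->|->]; first by rewrite /r cell_map_edge.
    rewrite /r edge_headE cell_map_vertex/= /p1 /edge_coboundary.
    by rewrite -(intrD _ 1 1) -intrM -intrD; congr _%:~R; ring.
  by rewrite /r edge_tailE cell_map_vertex/= /p1 addNr mulr0 addr0.
exists r.
  apply: paste_edges => e Ye; apply: (@eq_within_continuous _ _ _ (p1 e)).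
    by move=> s; rewrite /= in_itv/= => /rE ->.
  apply: withinD; first exact: within_cst.
  apply: withinM; first exact: within_cst.
  by apply: continuous_subspaceT => s; apply: cvgD; [exact: cvg_id|exact: cvg_cst].
apply: graph_ind => [u|e s Ye sI].
  apply: (congr2_trans (winding_map_vertex _ _)).
  by rewrite /r cell_map_vertex/= congr2_sym congr2_0int.
apply: (congr2_trans (winding_map_edge _ Ye sI)); rewrite rE// /p1 congr2_sym addrC.
exact: congr2_int2.
Qed.

(** A lift takes even values 2 v(u) at the vertices u. Along an edge it differs from w(e) (s + 1) by
    a continuous function with even values, hence by a constant; comparing s = 1 with s = -1 gives w
    as the coboundary of v. *)
Lemma winding_map_liftable w (r : X -> R) :
  {within union_cells Y, continuous r} ->
  (forall x, union_cells Y x -> congr2 (r x) (winding_map w x)) ->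
  exists v, forall e, Y 1 e -> w e = edge_coboundary v e.
Proof.
(* On the vertices of Y the argument of the floor is already an integer. *)
move=> cr rE; pose v (u : cell X 0) := Num.floor (r (vertex_pt u) / 2).
have vE u : union_cells Y (vertex_pt u) -> r (vertex_pt u) = (2 * v u)%:~R.
  move=> Yu; have /congr2P[n] := congr2_trans (rE _ Yu) (winding_map_vertex w u).
  rewrite subr0 /v => ->; rewrite intrM mulrAC divff ?pnatr_eq0// mul1r.
  by rewrite intrKfloor intrM.
exists v => e Ye; have I1 : -1 <= (1 : R) <= 1 by lra.
have IN1 : -1 <= (-1 : R) <= 1 by lra.
have : r (edge_path e 1) - (w e)%:~R * (1 + 1) = r (edge_path e (-1)) - (w e)%:~R * (-1 + 1).
  have H s : -1 <= s <= 1 -> congr2 (r (edge_path e s) - (w e)%:~R * (s + 1)) 0.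
    move=> sI; rewrite -(subrr ((w e)%:~R * (s + 1))); apply: congr2B (congr2_refl _).
    exact: congr2_trans (rE _ (edge_path_union Ye sI)) (winding_map_edge w Ye sI).
  apply: (@within_constant_even _ (-1) 1 (fun s => r (edge_path e s) - (w e)%:~R * (s + 1))).
  - lra.
  - apply: withinB.
      apply: (within_continuous_comp (@edge_path_continuous e) cr).
      by move=> s; rewrite /= in_itv; exact: edge_path_union.
    apply: withinM; first exact: within_cst.
    by apply: continuous_subspaceT => s; apply: cvgD; [exact: cvg_id|exact: cvg_cst].
  - move=> s; rewrite in_itv/= => sI; apply: congr2_trans (H _ sI) _.
    by rewrite congr2_sym; exact: H.
rewrite edge_headE edge_tailE !vE; last 2 first.
- by rewrite -edge_tailE; exact: edge_path_union.
- by rewrite -edge_headE; exact: edge_path_union.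
rewrite addNr mulr0 subr0 -(intrD _ 1 1) -intrM -intrB => /(@intr_inj R).
by rewrite /edge_coboundary; lia.
Qed.

(** A lift along e that starts at the value of th at the tail ends at its value at the head plus
    some 2 w(e). Subtracting w(e) (s + 1) removes this defect, and the corrected lifts agree at the
    vertices, so they form one real function r. *)
Lemma circle_map_winding_map (th : X -> R) : circle_continuous (union_cells Y) th ->
  exists w, exists2 r : X -> R, {within union_cells Y, continuous r} &
    forall x, union_cells Y x -> congr2 (th x) (r x + winding_map w x).
Proof.
move=> cth.
have lift e : exists l : R -> R, Y 1 e -> {within `[-1, 1]%classic, continuous l} /\
    (forall s, -1 <= s <= 1 -> congr2 (l s) (th (edge_path e s))) /\
    l (-1) = th (edge_path e (-1)).
  have [Ye|nYe] := pselect (Y 1 e); last by exists (fun=> 0).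
  have ce : circle_continuous (`[-1, 1]%classic : set R) (th \o edge_path e).
    apply: (circle_continuous_comp (@edge_path_continuous e) cth) => s.
    by rewrite /= in_itv; exact: edge_path_union.
  have star (x t : R) : `[-1, 1]%classic x -> 0 <= t <= 1 ->
      `[-1, 1]%classic (0 + t *: (x - 0)).
    rewrite /= !in_itv/= subr0 add0r => xI tI.
    by rewrite -ler_norml normrM mulr_ile1// ?ler_norml//; case/andP: tI => t0 t1; lra.
  have [l cl lE] := circle_lift (@segment_compact _ _ _) star ce.
  have lE' s : -1 <= s <= 1 -> congr2 (l s) (th (edge_path e s)).
    by move=> sI; apply: lE; rewrite /= in_itv.
  exists (fun s => l s + (th (edge_path e (-1)) - l (-1))) => _; split; [|split].
  - by apply: withinD => //; exact: within_cst.
  - move=> s sI; rewrite -[X in congr2 _ X]addr0; apply: congr2D; first exact: lE'.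
    rewrite -[X in congr2 _ X](subrr (th (edge_path e (-1)))).
    by apply: congr2B (congr2_refl _) _; apply: lE'; lra.
  - by rewrite addrC subrK.
have {lift}[l lP] := choice lift.
pose psi u := th (vertex_pt u).
have wex e : exists n : int, Y 1 e -> l e 1 - psi (edge_head e) = (2 * n)%:~R.
  have [Ye|nYe] := pselect (Y 1 e); last by exists 0.
  have [_ [lE _]] := lP e Ye; have /congr2P[n nE] := lE 1 ltac:(lra).
  by exists n => _; rewrite -nE edge_headE.
have [w wP] := choice wex.
pose p1 e s : R := l e s - (w e)%:~R * (s + 1).
pose r : X -> R := cell_map (by_dim psi p1 (fun _ _ => 0)).
have rE e s : Y 1 e -> -1 <= s <= 1 -> r (edge_path e s) = p1 e s.
  move=> Ye /edge_path_endpoint[sI|->|->]; first by rewrite /r cell_map_edge.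
    rewrite /r edge_headE cell_map_vertex/= /p1 -(intrD _ 1 1) -intrM mulrC.
    by rewrite -wP// opprB addrC subrK.
  rewrite /r edge_tailE cell_map_vertex/= /p1 addNr mulr0 subr0.
  by have [_ [_ ->]] := lP e Ye; rewrite edge_tailE.
exists w, r.
  apply: paste_edges => e Ye; apply: (@eq_within_continuous _ _ _ (p1 e)).
    by move=> s; rewrite /= in_itv/= => sI; rewrite rE.
  apply: withinB; first by have [] := lP e Ye.
  apply: withinM; first exact: within_cst.
  by apply: continuous_subspaceT => s; apply: cvgD; [exact: cvg_id|exact: cvg_cst].
apply: graph_ind => [u|e s Ye sI].
  rewrite /r cell_map_vertex/= congr2_sym -[X in congr2 _ X]addr0.
  exact: congr2D (congr2_refl _) (winding_map_vertex _ _).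
rewrite rE// congr2_sym; have [_ [lE _]] := lP e Ye.
apply: congr2_trans _ (lE s sI); rewrite -[X in congr2 _ X](subrK ((w e)%:~R * (s + 1))).
exact: congr2D (congr2_refl _) (winding_map_edge w Ye sI).
Qed.

End Graph.
End Cells.

(** * Integral cochains of a cellular disc *)

Section Degree.
Context {R : realType}.

Lemma congr2_small (a b : R) : 0 < b - a < 2 -> ~~ congr2 b a.
Proof.
move=> /andP[ab0 ab2]; apply/negP => /congr2P[n nE]; move: ab0 ab2; rewrite nE.
by rewrite (ltr_int _ 0) (ltr_int _ _ 2); lia.
Qed.

(** The two points cutting [a, b] into thirds are less than 2 apart, so at most one of them lies in
    the class of 1, and both are too close to a to lie in its class. *)
Lemma generic_value (a b : R) : a < b -> b <= a + 2 ->
  exists v, [/\ a < v < b, ~~ congr2 v 1 & ~~ congr2 v a].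
Proof.
move=> ab ba; pose v1 := a + (b - a) / 3; pose v2 := a + 2 * (b - a) / 3.
have [n1|n1] := boolP (congr2 v1 1); last first.
  exists v1; split=> //; [|apply: congr2_small]; rewrite /v1; apply/andP; split; lra.
exists v2; split; [| |apply: congr2_small]; rewrite ?/v2; try by apply/andP; split; lra.
apply/negP => n2; have : ~~ congr2 v2 v1.
  by apply: congr2_small; rewrite /v1 /v2; apply/andP; split; lra.
by move/negP; apply; apply: congr2_trans n2 _; rewrite congr2_sym.
Qed.

(** Two classes are exempt: that of 1, to which everything outside the edge is collapsed, and that
    of L 0, which a loop meets at both ends of [0, T]. *)
Definition generically_injective (T : R) (L : R -> R) :=
  forall t t', 0 <= t <= T -> 0 <= t' <= T -> congr2 (L t) (L t') ->
    ~~ congr2 (L t) 1 -> ~~ congr2 (L t) (L 0) -> t = t'.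

(** If d >= 2, the lift passes through some generic v and through v + 2, two visits to one class. If
    d = 0 and L rises above L 0, it passes through a generic value once on the way up and once on
    the way back. *)
Lemma generically_injective_le (T : R) (L : R -> R) (d : int) : 0 <= T ->
  {within `[0, T]%classic, continuous L} -> L T - L 0 = (2 * d)%:~R ->
  generically_injective T L ->
  d <= 1 /\ (d = 0 -> forall t, 0 <= t <= T -> L t <= L 0).
Proof.
move=> T0 cL LT iL.
have ivt a b v : 0 <= a -> a <= b -> b <= T ->
    (L a <= v <= L b) || (L b <= v <= L a) -> exists2 t, a <= t <= b & L t = v.
  move=> a0 ab bT vI; have [] := @IVT R L a b v ab.
  - by apply: continuous_subspaceW cL => t; rewrite /= !in_itv/= => /andP[? ?]; lra.
  - by rewrite ge_min le_max; case/orP: vI => /andP[-> ->]; rewrite ?orbT.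
  - by move=> t; rewrite in_itv/=; exists t.
split.
  rewrite leNgt; apply/negP => d1.
  have L4 : L 0 + 4 <= L T.
    rewrite -lerBrDl LT (ler_int _ 4); lia.
  have [v [/andP[v1 v2] n1 n0]] : exists v,
      [/\ L 0 < v < L 0 + 2, ~~ congr2 v 1 & ~~ congr2 v (L 0)].
    by apply: generic_value; lra.
  have [t tI tv] : exists2 t, 0 <= t <= T & L t = v.
    by apply: ivt => //; apply/orP; left; apply/andP; split; lra.
  have [t' tI' tv'] : exists2 t, 0 <= t <= T & L t = v + 2.
    by apply: ivt => //; apply/orP; left; apply/andP; split; lra.
  have tt' : t = t'.
    apply: iL => //; rewrite ?tv//.
    by rewrite tv' congr2_sym; exact: (congr2_int2 1).
  by move: tv'; rewrite -tt' tv => e; lra.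
move=> d0 t0 /andP[t00 t0T]; rewrite leNgt; apply/negP => Lt0.
have LT0 : L T = L 0 by apply/eqP; rewrite -subr_eq0 LT d0 mulr0.
have [v [/andP[v1 v2] n1 n0]] : exists v,
    [/\ L 0 < v < Num.min (L t0) (L 0 + 2), ~~ congr2 v 1 & ~~ congr2 v (L 0)].
  apply: generic_value; first by rewrite lt_min Lt0/=; lra.
  by rewrite ge_min lexx orbT.
rewrite lt_min in v2; case/andP: v2 => v2 v3.
have [t /andP[ta tb] tv] : exists2 t, 0 <= t <= t0 & L t = v.
  by apply: ivt => //; apply/orP; left; rewrite !ltW.
have [t' /andP[ta' tb'] tv'] : exists2 t, t0 <= t <= T & L t = v.
  by apply: ivt => //; apply/orP; right; rewrite LT0 !ltW.
have tt' : t = t'.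
  apply: iL; rewrite ?tv ?tv' ?congr2_refl//.
    by apply/andP; split; lra.
  by apply/andP; split; lra.
have : t = t0 by lra.
by move=> e; move: v2; rewrite -tv e ltxx.
Qed.

(** The class of 1 is its own opposite, so the bound applies to L and to -L: d lies between -1 and
    1, and d = 0 would force L to be constant. *)
Lemma generically_injective_degree (T : R) (L : R -> R) (d : int) : 0 <= T ->
  {within `[0, T]%classic, continuous L} -> L T - L 0 = (2 * d)%:~R ->
  generically_injective T L -> (exists2 t, 0 <= t <= T & L t != L 0) ->
  exists m : int, d = 2 * m + 1.
Proof.
move=> T0 cL LT iL [t tI Lt].
have [d1 dn] := generically_injective_le T0 cL LT iL.
have iN : generically_injective T (fun t => - L t).
  have N (a b : R) : congr2 (- a) (- b) = congr2 a b.
    by apply/idP/idP => /congr2N; rewrite ?opprK.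
  move=> s s' sI sI'; rewrite !N => e1 e2 e3; apply: iL => //.
  apply: contra e2 => e2; apply: (congr2_trans (congr2N e2)).
  by apply/congr2P; exists (-1); rewrite mulrN1 rmorphN/= -opprD.
have cN : {within `[0, T]%classic, continuous (fun t => - L t)}.
  by apply: (eq_within_continuous _ (withinB (@within_cst _ _ _ 0) cL)) => x _; rewrite sub0r.
have LN : - L T - - L 0 = (2 * - d)%:~R by rewrite -opprD LT mulrN rmorphN.
have [d1' dn'] := generically_injective_le T0 cN LN iN.
have [d0|d0] := eqVneq d 0.
  have h1 := dn d0 t tI; have := dn' _ t tI; rewrite d0 oppr0 => /(_ erefl).
  by rewrite lerN2 => h2; move: Lt; rewrite eq_le h1 h2.
have [->|->] : d = 1 \/ d = -1 by lia.
  by exists 0.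
by exists (-1).
Qed.
End Degree.

(** * Winding of circle maps along a loop in a finite graph *)

Section Loops.
Context {R : realType} {X : cellComplex2 R}.
Variable Y : subcomplex X.
Hypotheses (finY : forall k, finite_set (Y k)) (graphY : is_subgraph Y).
Variable c : R -> X.
Hypotheses (cc : {within `[0, 2 * pi]%classic, continuous c})
  (cY : forall t, 0 <= t <= 2 * pi -> union_cells Y (c t)) (c0 : c (2 * pi) = c 0).

Lemma within_loop (r : X -> R) : {within union_cells Y, continuous r} ->
  {within `[0, 2 * pi]%classic, continuous (r \o c)}.
Proof. by move=> cr; apply: (within_continuous_comp cc cr) => t; rewrite /= in_itv; exact: cY. Qed.

Lemma circle_loop_comp (F : X -> R) :
  circle_continuous (union_cells Y) F -> circle_loop (F \o c).
Proof.
move=> cF; split; last by rewrite /= c0 congr2_refl.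
by apply: (circle_continuous_comp cc cF) => t; rewrite /= in_itv; exact: cY.
Qed.

Lemma winding_circle_map (F r : X -> R) (w : cell X 1 -> int) :
  {within union_cells Y, continuous r} ->
  (forall x, union_cells Y x -> congr2 (F x) (r x + winding_map Y w x)) ->
  winding (F \o c) =
  \sum_(e <- fset_set (Y 1)) w e * winding (collapse e \o c).
Proof.
move=> cr FE; have wl : circle_loop (winding_map Y w \o c).
  by apply: circle_loop_comp; exact: winding_map_continuous.
have rl : circle_loop (r \o c).
  by apply: circle_loop_comp; exact: within_circle_continuous.
have -> : winding (F \o c) = winding (fun t => (r \o c) t + (winding_map Y w \o c) t).
  apply/esym/eq_winding; last exact: circle_loopD.
  by move=> t tI; rewrite congr2_sym; apply: FE; exact: cY.
rewrite windingD// winding_periodic ?add0r; last 2 first.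
- exact: within_loop.
- by rewrite /= c0.
exact: winding_map_loop.
Qed.

Lemma winding_edge_coboundary (v : cell X 0 -> int) :
  \sum_(e <- fset_set (Y 1)) edge_coboundary v e * winding (collapse e \o c) = 0.
Proof.
have [r cr rE] := winding_map_coboundary finY graphY v.
(* The zero map is congruent to -r plus the winding map, so its winding number 0 is the pairing in
   question. *)
rewrite -(@winding_circle_map (fun=> 0) (fun x => - r x)).
- by apply: winding_periodic => //; exact: within_cst.
- by apply: (eq_within_continuous _ (withinB (@within_cst _ _ _ 0) cr)) => x _; rewrite sub0r.
- move=> x Yx; rewrite addrC congr2_sym -[X in congr2 _ X](subrr (r x)).
  exact: congr2B (rE _ Yx) (congr2_refl _).
Qed.
End Loops.

(** * The 1-skeleton of a subcomplex and its attaching loops *)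

Section Skeleton.
Context {R : realType} {X : cellComplex2 R}.
Variable Y : subcomplex X.

Definition skeleton_cells k : set (cell X k) := [set s | Y k s /\ (k <= 1)%N].

Lemma skeleton_cells_closed k (s : cell X k) : skeleton_cells s ->
  char s @` @cball R k `<=` union_cells skeleton_cells.
Proof.
move=> [Ys k1] _ [u cu <-]; have [ou|su] := cballE cu.
  by exists k, s; split; [|exact: char_open_cell].
have [l [t [lk tx]]] := @char_boundary _ X _ s _ su; exists l, t; split=> //; split.
  by apply: (union_cells_open _ tx); exact: char_union_cells.
by rewrite ltnW// (leq_trans lk).
Qed.

Definition skeleton : subcomplex X := Subcomplex skeleton_cells_closed.

Lemma skeleton_graph : is_subgraph skeleton.
Proof.
move=> k k1; apply/seteqP; split=> // s [_]; by rewrite leqNgt k1.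
Qed.

Lemma skeleton_finite : (forall k, finite_set (Y k)) -> forall k, finite_set (skeleton k).
Proof. by move=> finY k; apply: sub_finite_set (finY k) => s []. Qed.

Lemma skeleton1 : skeleton 1 = Y 1.
Proof. by apply/seteqP; split=> [s []|s Ys]. Qed.

Lemma skeleton_union : union_cells skeleton `<=` union_cells Y.
Proof. by move=> x [k [s [[Ys _] sx]]]; exists k, s. Qed.

Lemma face_notin_skeleton (f : cell X 2) x : open_cell f x -> ~ union_cells skeleton x.
Proof. by move=> fx /union_cells_open/(_ fx)[]. Qed.

Lemma face_boundary_skeleton (f : cell X 2) u :
  Y 2 f -> usphere u -> union_cells skeleton (char f u).
Proof.
move=> Yf su; have [l [t [lk tx]]] := @char_boundary _ X _ f _ su.
exists l, t; split=> //; split; last by rewrite -ltnS.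
by apply: (union_cells_open _ tx); apply: char_union_cells => //; exact: usphere_cball.
Qed.

Lemma attaching_loop_continuous (f : cell X 2) :
  {within `[0, 2 * pi]%classic, continuous (attaching_loop f)}.
Proof.
apply: (within_continuous_comp (f := circle_pt) _ (@char_continuous _ _ _ f)).
  by apply: continuous_subspaceT; exact: circle_pt_continuous.
by move=> t _; exact: circle_pt_cball.
Qed.

Lemma attaching_loop_closed (f : cell X 2) :
  attaching_loop f (2 * pi) = attaching_loop f 0.
Proof. by rewrite /attaching_loop circle_pt2pi. Qed.

Lemma attaching_loop_skeleton (f : cell X 2) t :
  Y 2 f -> union_cells skeleton (attaching_loop f t).
Proof. by move=> Yf; apply: face_boundary_skeleton => //; exact: circle_pt_usphere. Qed.
End Skeleton.

(** * Integral cochains seen through the chart of a disc *)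

Section CellularDiscs.
Context {R : realType} {X : cellComplex2 R}.
Variables (D B : subcomplex X).
Hypotheses (finD : forall k, finite_set (D k)) (BD : sub_subcomplex B D).
Hypothesis graphB : is_subgraph B.
Variables (h : 'rV[R]_2 -> X) (k : X -> 'rV[R]_2).
Hypotheses (ch : {within @cball R 2, continuous h})
  (hD : forall u, cball u -> union_cells D (h u))
  (ck : {within union_cells D, continuous k})
  (kD : forall x, union_cells D x -> cball (k x))
  (hk : forall x, union_cells D x -> h (k x) = x)
  (kh : forall u, cball u -> k (h u) = u)
  (hB : h @` @usphere R 2 = union_cells B).

Let skD := skeleton D.
Let fsk := skeleton_finite finD.
Let gsk := skeleton_graph D.

Let finB l : finite_set (B l).
Proof. exact: sub_finite_set (BD (k := l)) (finD l). Qed.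

Definition boundary_loop (t : R) : X := h (circle_pt t).

Definition boundary_degree (e : cell X 1) : int := winding (collapse e \o boundary_loop).

Let cbl : {within `[0, 2 * pi]%classic, continuous boundary_loop}.
Proof.
apply: (within_continuous_comp (f := circle_pt) _ ch).
  by apply: continuous_subspaceT; exact: circle_pt_continuous.
by move=> t _; exact: circle_pt_cball.
Qed.

Let blB t : union_cells B (boundary_loop t).
Proof. by rewrite -hB; exists (circle_pt t) => //; exact: circle_pt_usphere. Qed.

Let bl0 : boundary_loop (2 * pi) = boundary_loop 0.
Proof. by rewrite /boundary_loop circle_pt2pi. Qed.

Let B_skD x : union_cells B x -> union_cells skD x.
Proof.
move=> [l [s [Bs sx]]]; exists l, s; split=> //; split; first exact: BD.
by rewrite leqNgt; apply/negP => l1; move: Bs; rewrite graphB.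
Qed.

Let k_inj x y : union_cells D x -> union_cells D y -> k x = k y -> x = y.
Proof. by move=> Dx Dy e; rewrite -(hk Dx) e hk. Qed.

Let cell_D l (s : cell X l) u : D l s -> cball u -> union_cells D (char s u).
Proof. exact: char_union_cells. Qed.

Let o0 : oball (0 : 'rV[R]_2).
Proof. by rewrite /oball/= (eqP (_ : sqnorm 0 == 0)) ?sqnorm_eq0. Qed.

Lemma face_dual_cochain f : D 2 f -> exists a : cell X 1 -> int,
  [/\ exists m : int, \sum_(e <- fset_set (D 1)) a e * attaching_degree f e = 2 * m + 1,
      forall f', D 2 f' -> f' != f ->
        \sum_(e <- fset_set (D 1)) a e * attaching_degree f' e = 0 &
      \sum_(e <- fset_set (D 1)) a e * boundary_degree e = 1].
Proof.
move=> Df; set p := k (char f 0); have D0 : union_cells D (char f 0).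
  by apply: cell_D => //; exact: oball_cball.
pose th x := ang (k x - p).
have notp x : union_cells D x -> ~ open_cell f x -> k x - p != 0.
  move=> Dx fx; rewrite subr_eq0; apply/eqP => e; apply: fx.
  by rewrite (k_inj Dx D0 e); exact: char_open_cell.
have ckp : {within union_cells D, continuous (fun x => k x - p)}.
  by move=> x; apply: cvgB; [exact: ck|exact: cvg_cst].
have cth : circle_continuous (union_cells skD) th.
  apply: (ang_circle_continuous (f := fun x => k x - p)).
    exact: continuous_subspaceW (@skeleton_union _ _ _) ckp.
  by move=> x sx; apply: notp (skeleton_union sx) _ => fx; exact: face_notin_skeleton fx sx.
have [w [r cr rE]] := circle_map_winding_map fsk gsk cth.
have degE f' : D 2 f' -> \sum_(e <- fset_set (D 1)) w e * attaching_degree f' e =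
    winding (th \o attaching_loop f').
  move=> Df'; rewrite (winding_circle_map fsk gsk _ _ _ cr rE).
  - by rewrite skeleton1; apply: eq_bigr => e _; rewrite attaching_degreeE.
  - exact: attaching_loop_continuous.
  - by move=> t _; exact: attaching_loop_skeleton.
  - exact: attaching_loop_closed.
exists w; split.
- rewrite degE//; apply: (winding_injective_disc (g := k \o char f)).
  + by apply: (within_continuous_comp (@char_continuous _ _ _ f) ck) => u; exact: cell_D.
  + move=> u v; rewrite !inE => ou ov /k_inj e.
    apply: (@char_inj _ _ _ f) => //; rewrite ?inE//.
    by apply: e; apply: cell_D => //; exact: oball_cball.
  + move=> u v su ov; apply/eqP => /k_inj e.
    apply: (@face_notin_skeleton _ _ D f (char f v)); first exact: char_open_cell.
    rewrite -e; [exact: face_boundary_skeleton|apply: cell_D => //|apply: cell_D => //].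
      exact: usphere_cball.
    exact: oball_cball.
(* The whole closed face f' avoids the center of f: open cells are disjoint and the boundary of f'
   lies in the skeleton. The angle is thus a circle map on the full ball of f'. *)
- move=> f' Df' ff'; rewrite degE//; apply: (winding_disc0 (F := th \o char f')).
  apply: (ang_circle_continuous (f := fun u => k (char f' u) - p)).
    apply: (within_continuous_comp (@char_continuous _ _ _ f') ckp) => u.
    exact: cell_D.
  move=> u cu; apply: notp; first exact: cell_D.
  have [ou|su] := cballE cu.
    move=> fu; move/eqP: ff'; apply.
    by apply: (open_cell_eq _ fu); exact: char_open_cell.
  by move=> fu; apply: face_notin_skeleton fu _; exact: face_boundary_skeleton Df' su.
- rewrite -skeleton1 -(winding_circle_map fsk gsk cbl _ bl0 cr rE); last first.
    by move=> t _; exact: B_skD.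
  have -> : th \o boundary_loop = fun t => ang (circle_pt t - p).
    apply/funext => t; rewrite /th /boundary_loop/= kh//; exact: circle_pt_cball.
  (* Were p on the unit circle, the center of f would lie in B, hence in the 1-skeleton. *)
  apply: winding_about_interior; have [//|sp] := cballE (kD D0).
  have : union_cells B (char f 0) by rewrite -hB; exists p => //; exact: hk.
  by move/B_skD => s0; case: (face_notin_skeleton (char_open_cell f o0) s0).
Qed.

Lemma integral_cocycle_coboundary (w : cell X 1 -> int) :
  (forall f, D 2 f -> \sum_(e <- fset_set (D 1)) w e * attaching_degree f e = 0) ->
  exists v, forall e, D 1 e -> w e = edge_coboundary v e.
Proof.
move=> w0.
have ext f : exists M : 'rV[R]_2 -> R, D 2 f -> {within @cball R 2, continuous M} /\
    forall u, usphere u -> congr2 (M u) (winding_map skD w (char f u)).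
  have [Df|nDf] := pselect (D 2 f); last by exists (fun=> 0).
  have lf : circle_loop (winding_map skD w \o attaching_loop f).
    apply: (circle_loop_comp (@attaching_loop_continuous _ _ f) _ (attaching_loop_closed f)
      (winding_map_continuous fsk gsk w)) => t _; exact: attaching_loop_skeleton.
  have [L [cL LE]] := windingP lf.
  rewrite winding_map_loop//; last 3 first.
  - exact: attaching_loop_continuous.
  - by move=> t _; exact: attaching_loop_skeleton.
  - exact: attaching_loop_closed.
  rewrite /skD skeleton1 (eq_bigr (fun e => w e * attaching_degree f e)); last first.
    by move=> e _; rewrite attaching_degreeE.
  rewrite w0// mulr0 => /eqP; rewrite subr_eq0 => /eqP L0.
  have [M cM ME] := cone_extension cL L0; exists M => _; split=> // u su.
  have [t /andP[t0 t1] ->] := usphere_circle_pt su.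
  have tI : 0 <= t <= 2 * pi by rewrite t0 ltW.
  by rewrite ME//; exact: LE.
have {ext}[M MP] := choice ext.
(* Modulo 2 this is the winding map on the skeleton, continued over each face by the cone M. Being a
   circle map on all of D, it lifts over the ball through h, and [winding_map_liftable] applies to
   the lift read back through k. *)
pose F : X -> R := cell_map (by_dim (fun=> 0) (fun e s => (w e)%:~R * (s + 1)) M).
have FE x : union_cells skD x -> congr2 (F x) (winding_map skD w x).
  move=> [[|[|l]] [s [Ys sx]]]; last by case: Ys.
  - move/open_vertex: sx => ->; rewrite /F cell_map_vertex/= congr2_sym.
    exact: winding_map_vertex.
  - have [a aI ->] := open_edgeP sx; rewrite /F cell_map_edge// congr2_sym.
    apply: winding_map_edge => //; move: aI => /andP[? ?]; by rewrite !ltW.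
have FM f u : D 2 f -> cball u -> congr2 (M f u) (F (char f u)).
  move=> Df cu; have [cM ME] := MP f Df; have [ou|su] := cballE cu.
    by rewrite /F cell_mapE//= congr2_refl.
  apply: congr2_trans (ME _ su) _; rewrite congr2_sym; apply: FE.
  exact: face_boundary_skeleton.
have cFchar l (s : cell X l) : D l s -> circle_continuous (@cball R l) (F \o char s).
  case: l s => [|[|[|l]]] s Ds.
  - apply: (@eq_circle_continuous _ _ _ (fun=> 0)).
      move=> u _; rewrite /F /= cell_mapE ?congr2_refl//; exact: oball0.
    exact/within_circle_continuous/within_cst.
  - apply: (@eq_circle_continuous _ _ _ (fun u : 'rV[R]_1 => (w s)%:~R * (u 0 0 + 1))).
      move=> u cu; rewrite congr2_sym; rewrite (rV1E u) in cu *; move/cball1: cu => cu.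
      rewrite mxE; apply: congr2_trans (winding_map_edge fsk w _ cu); last by split.
      by apply: FE; apply: edge_path_union => //; split.
    apply: within_circle_continuous; apply: withinM; first exact: within_cst.
    apply: withinD; last exact: within_cst.
    by apply: continuous_subspaceT; exact: coord_continuous.
  - have [cM ME] := MP s Ds.
    apply: (eq_circle_continuous _ (within_circle_continuous cM)) => u cu.
    exact: FM.
  - by have := cell_dim s.
have cF : circle_continuous (union_cells D) F.
  by split; apply: paste_cells => // l s /cFchar[].
have cFh : circle_continuous (@cball R 2) (F \o h) by exact: circle_continuous_comp ch cF hD.
have [L cL LE] := circle_lift (@cball_compact _ _) (@cball_star _ _) cFh.
have [] := @winding_map_liftable _ _ skD fsk w (L \o k).
- apply: continuous_subspaceW (@skeleton_union _ _ _) _.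
  exact: within_continuous_comp ck cL kD.
- move=> x sx; apply: congr2_trans (FE _ sx).
  have Dx := skeleton_union sx.
  by have := LE _ (kD Dx); rewrite /= hk.
by move=> v vE; exists v => e De; apply: vE; split.
Qed.

(** This is delta delta = 0 over the integers: the circle map of a coboundary lifts to the reals on
    the skeleton, so it cannot wind along an attaching loop. *)
Lemma attaching_degree_coboundary v f : D 2 f ->
  \sum_(e <- fset_set (D 1)) edge_coboundary v e * attaching_degree f e = 0.
Proof.
move=> Df; rewrite -[RHS](winding_edge_coboundary fsk gsk (@attaching_loop_continuous _ _ f) _
  (attaching_loop_closed f) v); last by move=> t _; exact: attaching_loop_skeleton.
by rewrite skeleton1; apply: eq_bigr => e _; rewrite attaching_degreeE.
Qed.

Lemma boundary_degree_coboundary v :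
  \sum_(e <- fset_set (B 1)) edge_coboundary v e * boundary_degree e = 0.
Proof. by apply: winding_edge_coboundary => // t _; exact: blB. Qed.

Lemma boundary_degree_out e : ~ B 1 e -> boundary_degree e = 0.
Proof.
move=> Be; rewrite /boundary_degree (_ : _ \o _ = fun=> 1).
  by apply: winding_periodic => //; exact: within_cst.
apply/funext => t; rewrite /= collapse_out// => et; apply: Be.
exact: union_cells_open (blB t) et.
Qed.

(* Each point of an open boundary edge is passed exactly once, so a lift of the
   loop takes each class modulo 2 other than 1 exactly once on [0, 2 pi[. *)
Lemma boundary_degree_odd e : B 1 e -> exists m : int, boundary_degree e = 2 * m + 1.
Proof.
move=> Be; have ce : circle_loop (collapse e \o boundary_loop).
  by apply: (circle_loop_comp cbl _ bl0 (@collapse_continuous _ _ B finB graphB e)).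
have [L [cL LE] Ld] := windingP ce; have T0 : 0 <= 2 * pi :> R by rewrite mulr_ge0 ?pi_ge0.
apply: (generically_injective_degree T0 cL Ld).
  have in_e t : 0 <= t <= 2 * pi -> ~~ congr2 (L t) 1 ->
      exists2 s, -1 < s < 1 & boundary_loop t = edge_path e s /\ congr2 (L t) s.
    move=> tI n1; have [/open_edgeP[s sI be]|ne] := pselect (open_cell e (boundary_loop t)).
      exists s => //; split=> //; apply: congr2_trans (LE _ tI) _.
      by rewrite /= be collapse_in// congr2_refl.
    by move/negP: n1; case; apply: congr2_trans (LE _ tI) _; rewrite /= collapse_out// congr2_refl.
  have interior t : 0 <= t <= 2 * pi -> ~~ congr2 (L t) (L 0) -> 0 <= t < 2 * pi.
    move=> /andP[-> t2] n0; rewrite lt_neqAle t2 andbT; apply: contraNneq n0 => ->.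
    by apply/congr2P; exists (winding (collapse e \o boundary_loop)).
  move=> t t' tI tI' tt n1 n0.
  have n1' : ~~ congr2 (L t') 1 by apply: contra n1; exact: congr2_trans.
  have n0' : ~~ congr2 (L t') (L 0) by apply: contra n0; exact: congr2_trans.
  have [s sI [bs Ls]] := in_e t tI n1; have [s' sI' [bs' Ls']] := in_e t' tI' n1'.
  apply: circle_pt_inj; [exact: interior|exact: interior|].
  rewrite -(kh (circle_pt_cball t)) -(kh (circle_pt_cball t')); congr k.
  rewrite -/(boundary_loop t) -/(boundary_loop t') bs bs'; congr edge_path.
  have ss : congr2 s s'.
    by apply: congr2_trans (congr2_trans tt Ls'); rewrite congr2_sym.
  apply/eqP; apply: contraTT ss => ne; move: sI sI' => /andP[? ?] /andP[? ?].
  have [lt|lt|e0] := ltgtP s s'; last by rewrite e0 eqxx in ne.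
    by rewrite congr2_sym; apply: congr2_small; apply/andP; split; lra.
  by apply: congr2_small; apply/andP; split; lra.
have reach s : -1 < s < 1 -> exists2 t, 0 <= t <= 2 * pi & congr2 (L t) s.
  move=> sI; have : union_cells B (edge_path e s).
    by apply: edge_path_union => //; case/andP: sI => ? ?; rewrite !ltW.
  rewrite -hB => -[u su hu]; have [t /andP[t0 t1] tE] := usphere_circle_pt su.
  have tI : 0 <= t <= 2 * pi by rewrite t0 ltW.
  exists t => //; apply: congr2_trans (LE _ tI) _.
  by rewrite /= /boundary_loop -tE hu collapse_in ?congr2_refl.
(* L is not constant, as it meets the distinct classes of 0 and 1/2; at least one of t and t' gives
   a value other than L 0. *)
have [t tI Lt] := reach 0 ltac:(lra); have [t' tI' Lt'] := reach (1 / 2) ltac:(lra).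
have [e0|] := eqVneq (L t) (L 0); last by exists t.
exists t' => //; apply: contraTneq Lt' => ->; rewrite -e0.
apply/negP => Lt'; have : ~~ congr2 (1 / 2 : R) 0 by apply: congr2_small; apply/andP; split; lra.
by move/negP; apply; apply: congr2_trans _ Lt; rewrite congr2_sym.
Qed.

(** The angle about the center of the chart is a circle map on B that winds once along the boundary;
    a is its cochain. *)
Lemma boundary_pairing_onto : exists a : cell X 1 -> int,
  \sum_(e <- fset_set (B 1)) a e * boundary_degree e = 1.
Proof.
have BDu x : union_cells B x -> union_cells D x by move=> /B_skD/skeleton_union.
have kS x : union_cells B x -> usphere (k x).
  rewrite -hB => -[u su <-]; rewrite kh//; exact: usphere_cball.
have cth : circle_continuous (union_cells B) (ang \o k).
  apply: ang_circle_continuous; first exact: continuous_subspaceW BDu ck.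
  move=> x /kS; apply: contraPneq => ->.
  by rewrite /usphere/= (eqP (_ : sqnorm 0 == 0)) ?sqnorm_eq0// => /esym/eqP; rewrite oner_eq0.
have [w [r cr rE]] := circle_map_winding_map finB graphB cth.
exists w; rewrite -(winding_circle_map finB graphB cbl _ bl0 cr rE)//.
rewrite -(winding_about_interior o0); congr winding; apply/funext => t.
by rewrite /boundary_loop /= kh ?subr0//; exact: circle_pt_cball.
Qed.

(** A vanishing pairing makes the lift of the winding map along the boundary loop periodic. Coning
    it off over the disc and composing with k exhibits it as a continuous real function on B, which
    lifts the winding map there. *)
Lemma boundary_pairing_kernel (w : cell X 1 -> int) :
  \sum_(e <- fset_set (B 1)) w e * boundary_degree e = 0 ->
  exists v, forall e, B 1 e -> w e = edge_coboundary v e.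
Proof.
move=> w0; have lb : circle_loop (winding_map B w \o boundary_loop).
  by apply: (circle_loop_comp cbl _ bl0 (winding_map_continuous finB graphB w)).
have [L [cL LE]] := windingP lb.
rewrite winding_map_loop// w0 mulr0 => /eqP; rewrite subr_eq0 => /eqP L0.
have [M cM ME] := cone_extension cL L0.
have BDu x : union_cells B x -> union_cells D x by move=> /B_skD/skeleton_union.
apply: (winding_map_liftable finB (r := M \o k)).
  by apply: (within_continuous_comp (continuous_subspaceW BDu ck) cM) => x /BDu/kD.
move=> x; rewrite -hB => -[u su <-]; rewrite /= kh; last exact: usphere_cball.
have [t /andP[t0 t1] ->] := usphere_circle_pt su.
have tI : 0 <= t <= 2 * pi by rewrite t0 ltW.
by rewrite ME//; exact: LE.
Qed.
End CellularDiscs.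

(** * Cochains modulo 2 *)

Section ModTwo.

Lemma Z2_two : 2%:~R = 0 :> 'Z_2.
Proof. exact/val_inj. Qed.

Lemma Z2_addrr (x : 'Z_2) : x + x = 0.
Proof. by rewrite -mulr2n -mulr_natr (Z2_two : 2%:R = 0 :> 'Z_2) mulr0. Qed.

Lemma Z2_oppr (x : 'Z_2) : - x = x.
Proof. by apply/eqP; rewrite eq_sym -subr_eq0 opprK Z2_addrr. Qed.

Lemma Z2_odd (n m : int) : n = 2 * m + 1 -> n%:~R = 1 :> 'Z_2.
Proof. by move=> ->; rewrite intrD intrM Z2_two mul0r add0r. Qed.

Lemma Z2_even (n : int) : n%:~R = 0 :> 'Z_2 -> exists m, n = 2 * m.
Proof.
move=> n0; have [m [b e]] : exists m (b : bool), n = 2 * m + b%:Z.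
  exists (n %/ 2)%Z, ((n %% 2)%Z == 1); rewrite [LHS](divz_eq n 2) mulrC; congr (_ + _).
  by have := modz_ge0 n (isT : 2 != 0 :> int); have := ltz_pmod n (isT : 0 < 2 :> int);
    case: eqP => /=; lia.
case: b e => e; last by exists m; rewrite e addr0.
by move: n0; rewrite (Z2_odd e) => /eqP; rewrite oner_eq0.
Qed.

Definition Z2_lift (x : 'Z_2) : int := Posz x.

Lemma Z2_liftK x : (Z2_lift x)%:~R = x.
Proof. exact: natr_Zp. Qed.

Lemma Z2_prod_odd (I : Type) (r : seq I) (P : pred I) (F : I -> int) :
  (forall i, (F i)%:~R = 1 :> 'Z_2) -> (\prod_(i <- r | P i) F i)%:~R = 1 :> 'Z_2.
Proof. by move=> F1; rewrite rmorph_prod/= big1. Qed.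
End ModTwo.

Section Coboundary.
Context {R : realType} {X : cellComplex2 R}.

(** Loops are covered as well: their two ends coincide, and both the incidence number and the
    difference cancel. *)
Lemma coboundary_edgeE (v : cell X 0 -> 'Z_2) (e : cell X 1) :
  coboundary v e = v (edge_head e) - v (edge_tail e).
Proof.
have inc u : incidence e u = ((u == edge_head e) : nat)%:R + ((u == edge_tail e) : nat)%:R :> 'Z_2.
  have E s w : edge_path e s = vertex_pt w ->
      `[< open_cell u (char e (const_mx s)) >] = (u == w).
    rewrite -/(edge_path e s) => ->; apply/asboolP/eqP => [uw|->]; last exact/open_vertex.
    by apply: (open_cell_eq uw); exact/open_vertex.
  by rewrite /incidence/= (E _ _ (edge_headE e)) (E _ _ (edge_tailE e)).
have bd (s : R) w : s ^+ 2 = 1 -> edge_path e s = vertex_pt w -> boundary_cells e 0 w.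
  move=> s1 ew; exists (edge_path e s); split; last exact/open_vertex.
  by exists (const_mx s) => //; exact: usphere1.
have bh := bd _ _ (expr1n _ 2) (edge_headE e).
have bt := bd _ _ (sqrr_sign _ 1) (edge_tailE e).
rewrite Z2_oppr /coboundary fsbig_finite; last exact: closure_finite.
have fin : finite_set (boundary_cells e 0) by exact: closure_finite.
have pick w : boundary_cells e 0 w ->
    \sum_(u <- fset_set (boundary_cells e 0)) ((u == w) : nat)%:R * v u = v w.
  move=> bw; have wI : w \in enum_fset (fset_set (boundary_cells e 0)).
    by rewrite in_fset_set// inE.
  rewrite (bigD1_seq w wI (fset_uniq _))/= eqxx mul1r big1 ?addr0// => u /negbTE ->.
  by rewrite mul0r.
rewrite -(pick _ bh) -(pick _ bt) -big_split; apply: eq_bigr => u _.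
by rewrite inc mulrDl.
Qed.

Variable D : subcomplex X.
Hypothesis finD : forall k, finite_set (D k).

Lemma attaching_degree_out (f : cell X 2) e : ~ boundary_cells f 1 e -> attaching_degree f e = 0.
Proof.
move=> fe; rewrite attaching_degreeE (_ : _ \o _ = fun=> 1).
  by apply: winding_periodic => //; exact: within_cst.
apply/funext => t; rewrite /= collapse_out// => et; apply: fe.
exists (attaching_loop f t); split=> //.
by exists (circle_pt t) => //; exact: circle_pt_usphere.
Qed.

(** Summing over all edges of D instead of the boundary cells of f gives the faces a common index
    set, on which sums can be exchanged. *)
Lemma coboundary_faceE (c : cell X 1 -> 'Z_2) f : D 2 f ->
  coboundary c f = \sum_(e <- fset_set (D 1)) (attaching_degree f e)%:~R * c e.
Proof.
move=> Df; rewrite -fsbig_finite//; apply: fsbig_widen => [e|e [_ fe]].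
  exact: boundary_subcells.
by rewrite /= attaching_degree_out// mul0r.
Qed.

Lemma coboundary_int (w : cell X 1 -> int) f : D 2 f ->
  coboundary (fun e => (w e)%:~R) f =
  (\sum_(e <- fset_set (D 1)) w e * attaching_degree f e)%:~R.
Proof.
move=> Df; rewrite coboundary_faceE// rmorph_sum/=; apply: eq_bigr => e _.
by rewrite intrM mulrC.
Qed.
End Coboundary.

(** * Vanishing theorems modulo 2 for the disc, and the Stokes formula *)

Section DiscCohomology.
Context {R : realType} {X : cellComplex2 R}.
Variable D : cellularDisc X.
Local Notation B := (disc_boundary D).
Hypothesis graphB : is_subgraph B.

Let finD := disc_finite D.
Let finB l : finite_set (B l).
Proof. exact: sub_finite_set (@disc_boundary_sub _ _ D l) (finD l). Qed.


Lemma disc_chart : exists (h : 'rV[R]_2 -> X) (k : X -> 'rV[R]_2),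
  ({within @cball R 2, continuous h} /\ {within union_cells D, continuous k}) /\
  [/\ forall u, cball u -> union_cells D (h u),
      forall x, union_cells D x -> cball (k x),
      forall x, union_cells D x -> h (k x) = x,
      forall u, cball u -> k (h u) = u &
      h @` @usphere R 2 = union_cells B].
Proof.
have [h [[hS _ hsurj] ch [k ck kh]] hB] := disc_homeo D.
have {}kh u : cball u -> k (h u) = u by move=> cu; apply: kh; rewrite inE.
exists h, k; split=> //; split=> //.
- by move=> x /hsurj[u cu <-]; rewrite kh.
- by move=> x /hsurj[u cu <-]; rewrite kh.
Qed.

Local Notation E := (enum_fset (fset_set (D 1))).
Local Notation EB := (enum_fset (fset_set (B 1))).
Local Notation F := (enum_fset (fset_set (D 2))).

Let memF f : (f \in F) = `[< D 2 f >].
Proof. by rewrite in_fset_set; [apply/idP/asboolP; rewrite inE|exact: finD]. Qed.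

Let memEB e : (e \in EB) = `[< B 1 e >].
Proof. by rewrite in_fset_set; [apply/idP/asboolP; rewrite inE|exact: finB]. Qed.

(** Here b is the boundary degree. Being odd on the boundary edges, it turns the integral pairing
    into the plain sum over these edges modulo 2. The rest of this section uses the chart only
    through this lemma and [integral_exactness]. *)
Lemma boundary_pairing : exists b : cell X 1 -> int,
  [/\ forall e, B 1 e -> (b e)%:~R = 1 :> 'Z_2,
      forall v, \sum_(e <- EB) edge_coboundary v e * b e = 0,
      exists a, \sum_(e <- EB) a e * b e = 1,
      forall w, \sum_(e <- EB) w e * b e = 0 ->
        exists v, forall e, B 1 e -> w e = edge_coboundary v e &
      forall f, D 2 f -> exists a : cell X 1 -> int,
        [/\ (\sum_(e <- E) a e * attaching_degree f e)%:~R = 1 :> 'Z_2,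
          forall f', D 2 f' -> f' != f -> \sum_(e <- E) a e * attaching_degree f' e = 0 &
          \sum_(e <- EB) a e * b e = 1]].
Proof.
have [h [k [[ch ck] [hD kD hk kh hB]]]] := disc_chart.
have BD := disc_boundary_sub D; exists (boundary_degree h); split.
- move=> e Be; have [m mE] := boundary_degree_odd finD BD graphB ch kh hB Be.
  exact: Z2_odd mE.
- move=> v; exact: (boundary_degree_coboundary finD BD graphB ch hB v).
- exact: (boundary_pairing_onto finD BD graphB ch ck kh hB).
- move=> w; exact: (boundary_pairing_kernel finD BD graphB ch ck kD kh hB).
- move=> f Df; have [a [[m mE] a0 a1]] := face_dual_cochain finD BD graphB ch ck kD hk kh hB Df.
  exists a; split=> //; first exact: Z2_odd mE.
  rewrite -a1 -!fsbig_finite; [|exact: finD|exact: finB].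
  apply: fsbig_widen; first exact: BD.
  by move=> e [_ Be]; rewrite /= (boundary_degree_out hB Be) mulr0.
Qed.

Lemma integral_exactness (w : cell X 1 -> int) :
  (forall f, D 2 f -> \sum_(e <- E) w e * attaching_degree f e = 0) ->
  exists v, forall e, D 1 e -> w e = edge_coboundary v e.
Proof.
have [h [k [[ch ck] [hD kD hk kh hB]]]] := disc_chart.
exact: (integral_cocycle_coboundary finD ch hD ck kD hk).
Qed.

(* Integral cochains dual to the faces pair with the faces by odd numbers, not
   necessarily by 1; an odd multiple of the lift of [c] is reduced by them to an
   integral cocycle, and odd factors disappear modulo 2. *)
Lemma mod2_decomposition : exists a : cell X 2 -> cell X 1 -> 'Z_2,
  [/\ forall f f', D 2 f -> D 2 f' -> coboundary (a f) f' = (f' == f)%:R,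
      forall f, D 2 f -> \sum_(e <- EB) a f e = 1 &
      forall c : cell X 1 -> 'Z_2, exists v : cell X 0 -> 'Z_2, forall e, D 1 e ->
        c e = \sum_(f <- F) coboundary c f * a f e + coboundary v e].
Proof.
have [b [b1 _ _ _ aP]] := boundary_pairing.
have /choice[a {}aP] : forall f, exists a : cell X 1 -> int, D 2 f ->
    [/\ (\sum_(e <- E) a e * attaching_degree f e)%:~R = 1 :> 'Z_2,
      forall f', D 2 f' -> f' != f -> \sum_(e <- E) a e * attaching_degree f' e = 0 &
      \sum_(e <- EB) a e * b e = 1].
  by move=> f; have [Df|nDf] := pselect (D 2 f); [have [a] := aP f Df; exists a|exists (fun=> 0)].
exists (fun f e => (a f e)%:~R); split.
- move=> f f' Df Df'; have [a1 a0 _] := aP f Df; rewrite (coboundary_int finD)//.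
  by case: eqVneq => [->//|/a0 ->].
- move=> f Df; have [_ _ ab] := aP f Df.
  transitivity (1%:~R : 'Z_2) => //; rewrite -ab rmorph_sum/=; apply: eq_big_seq => e.
  by rewrite memEB => /asboolP /b1 be; rewrite intrM be mulr1.
move=> c; pose w e := Z2_lift (c e).
pose dw (u : cell X 1 -> int) f := \sum_(e <- E) u e * attaching_degree f e.
(* The value 1 off the list makes [kf] odd everywhere, as [Z2_prod_odd] requires. *)
pose kf f := if f \in F then dw (a f) f else 1.
have kf1 f : (kf f)%:~R = 1 :> 'Z_2.
  by rewrite /kf memF; case: asboolP => // Df; have [] := aP f Df.
(* Over the rationals, subtracting (dw w f / kf f) a f from w for every face f would leave a
   cocycle. Multiplication by K = N f * kf f makes it the integral cochain W, and K and all N f are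
   1 modulo 2. *)
pose K := \prod_(f <- F) kf f; pose N f := \prod_(f' <- F | f' != f) kf f'.
have KN f : f \in F -> K = N f * kf f.
  by move=> Ff; rewrite /K (bigD1_seq f Ff (fset_uniq _)) mulrC.
pose W e := K * w e - \sum_(f <- F) N f * dw w f * a f e.
have W0 f0 : D 2 f0 -> dw W f0 = 0.
  move=> Df0; have F0 : f0 \in F by rewrite memF; exact/asboolP.
  rewrite /dw /W (eq_bigr (fun e => K * (w e * attaching_degree f0 e) -
      \sum_(f <- F) N f * dw w f * (a f e * attaching_degree f0 e))); last first.
    move=> e _; rewrite mulrBl mulrA mulr_suml; congr (_ - _).
    by apply: eq_bigr => f _; rewrite mulrA.
  rewrite sumrB -mulr_sumr exchange_big/= (bigD1_seq f0 F0 (fset_uniq _))/=.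
  rewrite -mulr_sumr [X in _ - (_ + X)]big_seq_cond [X in _ - (_ + X)]big1 ?addr0; last first.
    move=> f /andP[]; rewrite memF => /asboolP Df ff0; rewrite -mulr_sumr.
    by have [_ -> //] := aP f Df; rewrite ?mulr0// eq_sym.
  rewrite (KN f0 F0) /kf F0 -/(dw w f0) -/(dw (a f0) f0); ring.
have [v vE] := integral_exactness W0; exists (fun u => (v u)%:~R) => e De.
have := congr1 (fun n : int => n%:~R : 'Z_2) (vE e De); rewrite /W /edge_coboundary.
rewrite !intrB intrM /K Z2_prod_odd// mul1r Z2_liftK rmorph_sum/= => /eqP.
rewrite subr_eq addrC => /eqP ->; rewrite coboundary_edgeE; congr (_ + _).
apply: eq_big_seq => f; rewrite memF => /asboolP Df; rewrite !intrM /N Z2_prod_odd// mul1r.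
congr (_ * _); rewrite /dw -(coboundary_int finD)//.
by apply: eq_fsbigr => e' _; rewrite Z2_liftK.
Qed.

Lemma disc_H2_trivial (z : cell X 2 -> 'Z_2) :
  exists d : cell X 1 -> 'Z_2, forall f, D 2 f -> coboundary d f = z f.
Proof.
have [a [a1 _ _]] := mod2_decomposition.
exists (fun e => \sum_(f <- F) z f * a f e) => f Df.
have Ff : f \in F by rewrite memF; exact/asboolP.
rewrite (coboundary_faceE finD)//.
rewrite (eq_bigr (fun e => \sum_(f' <- F) z f' * ((attaching_degree f e)%:~R * a f' e))).
  rewrite exchange_big/= (bigD1_seq f Ff (fset_uniq _))/= -mulr_sumr.
  rewrite -(coboundary_faceE finD)// a1// eqxx mulr1 big_seq_cond big1 ?addr0// => f'.
  rewrite memF => /andP[/asboolP Df' ff']; rewrite -mulr_sumr -(coboundary_faceE finD)//.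
  by rewrite a1// eq_sym (negbTE ff') mulr0.
by move=> e _; rewrite mulr_sumr; apply: eq_bigr => f' _; rewrite mulrCA.
Qed.

Lemma disc_H1_trivial (c : cell X 1 -> 'Z_2) :
  (forall f, D 2 f -> coboundary c f = 0) ->
  exists v : cell X 0 -> 'Z_2, forall e, D 1 e -> c e = coboundary v e.
Proof.
move=> c0; have [a [_ _ /(_ c)[v vE]]] := mod2_decomposition; exists v => e De.
rewrite vE// big_seq big1 ?add0r// => f; rewrite memF => /asboolP Df.
by rewrite c0// mul0r.
Qed.

Lemma coboundary_coboundary (v : cell X 0 -> 'Z_2) f :
  D 2 f -> coboundary (coboundary v) f = 0.
Proof.
move=> Df; pose u x := Z2_lift (v x).
transitivity (coboundary (fun e => (edge_coboundary u e)%:~R) f : 'Z_2).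
  by apply: eq_fsbigr => e _; rewrite coboundary_edgeE intrB !Z2_liftK.
by rewrite (coboundary_int finD)// (attaching_degree_coboundary finD).
Qed.

Lemma boundary_sum_coboundary (v : cell X 0 -> 'Z_2) :
  \sum_(e <- EB) coboundary v e = 0.
Proof.
have [b [b1 b0 _ _ _]] := boundary_pairing; pose u x := Z2_lift (v x).
transitivity (0%:~R : 'Z_2) => //; rewrite -(b0 u) rmorph_sum/=; apply: eq_big_seq => e.
rewrite memEB => /asboolP /b1 be.
by rewrite intrM be mulr1 coboundary_edgeE intrB !Z2_liftK.
Qed.

(** An integral lift of c has an even pairing 2 m, not necessarily 0. Subtracting 2 m times a
    cochain of pairing 1 makes it 0 without changing the class modulo 2. *)
Lemma boundary_sum_eq0 (c : cell X 1 -> 'Z_2) : \sum_(e <- EB) c e = 0 ->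
  exists v : cell X 0 -> 'Z_2, forall e, B 1 e -> c e = coboundary v e.
Proof.
move=> c0; have [b [b1 _ [a a1] ker _]] := boundary_pairing.
pose w e := Z2_lift (c e).
have /Z2_even[m mE] : (\sum_(e <- EB) w e * b e)%:~R = 0 :> 'Z_2.
  rewrite -[RHS]c0 rmorph_sum/=; apply: eq_big_seq => e; rewrite memEB => /asboolP /b1 be.
  by rewrite intrM be mulr1 Z2_liftK.
have [] := ker (fun e => w e - 2 * m * a e).
  rewrite (eq_bigr (fun e => w e * b e - 2 * m * (a e * b e))).
    by rewrite sumrB -mulr_sumr a1 mulr1 mE subrr.
  by move=> e _; rewrite mulrBl mulrA.
move=> v vE; exists (fun u => (v u)%:~R) => e Be.
have := congr1 (fun n : int => n%:~R : 'Z_2) (vE e Be).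
rewrite /edge_coboundary intrB intrM intrM Z2_two mul0r mul0r subr0 Z2_liftK => ->.
by rewrite coboundary_edgeE intrB.
Qed.

Lemma boundary_sum_onto : exists c : cell X 1 -> 'Z_2, \sum_(e <- EB) c e = 1.
Proof.
have [b [b1 _ [a a1] _ _]] := boundary_pairing; exists (fun e => (a e)%:~R).
transitivity (1%:~R : 'Z_2) => //; rewrite -a1 rmorph_sum/=; apply: eq_big_seq => e.
by rewrite memEB => /asboolP /b1 be; rewrite intrM be mulr1.
Qed.

(** No count of the faces around an interior edge is made. In the decomposition of c the coboundary
    of v contributes 0 around the boundary, and each cochain [a f] contributes its coefficient, the
    curvature at f. *)
Lemma disc_stokes (c : cell X 1 -> 'Z_2) :
  \sum_(f <- F) coboundary c f = \sum_(e <- EB) c e.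
Proof.
have [a [_ aB /(_ c)[v vE]]] := mod2_decomposition.
rewrite [RHS](eq_big_seq (fun e => \sum_(f <- F) coboundary c f * a f e + coboundary v e)).
  rewrite big_split/= boundary_sum_coboundary addr0 exchange_big/=.
  apply: eq_big_seq => f; rewrite memF => /asboolP Df.
  by rewrite -mulr_sumr aB// mulr1.
move=> e; rewrite memEB => /asboolP Be; apply: vE; exact: disc_boundary_sub.
Qed.
End DiscCohomology.

(** * Cohomology of the disc *)

Section Cohomology.
Context {R : realType} {X : cellComplex2 R}.
Implicit Types Y A : subcomplex X.

Definition restrict Y k (c : cell X k -> 'Z_2) : cochain Y k := fun s => c (val s).

Lemma sub_coboundary_restrict Y k (c : cell X k -> 'Z_2) (s : Y k.+1) :
  sub_coboundary (restrict c : cochain Y k) s = coboundary c (val s).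
Proof.
apply: eq_coboundary => t /set_mem ts.
have Yt := boundary_subcells (set_valP s) ts.
by rewrite -[t]/(val (SigSub (mem_set Yt) : Y k)) extend0E.
Qed.

Lemma extend0_restrict Y k (c : cell X k -> 'Z_2) s :
  Y k s -> extend0 (restrict c : cochain Y k) s = c s.
Proof. by move=> Ys; rewrite -[s]/(val (SigSub (mem_set Ys) : Y k)) extend0E. Qed.

Lemma cohomology_classB Y A k (x y : cocycle Y A k) :
  cohomology_class (x - y) = cohomology_class x - cohomology_class y.
Proof. by rewrite /cohomology_class raddfB. Qed.

Lemma cohomology_class_eq Y A k (x y : cocycle Y A k) :
  cohomology_class x = cohomology_class y <-> x - y \in coboundaries Y A k.
Proof. by rewrite Quotient.idealrBE; split=> /eqP. Qed.

Lemma cohomology_class_eq0 Y A k (x : cocycle Y A k) :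
  cohomology_class x = 0 <-> x \in coboundaries Y A k.
Proof.
by have := cohomology_class_eq x 0; rewrite subr0 /cohomology_class raddf0.
Qed.

Lemma cohomology_class_surj Y A k (xi : rel_cohomology Y A k) :
  exists z, xi = cohomology_class z.
Proof. by exists (repr xi); rewrite /cohomology_class reprK. Qed.

Lemma cohomology_factor Y A k (W : zmodType) (f : cocycle Y A k -> W) :
  zmod_morphism f -> (forall z, z \in coboundaries Y A k -> f z = 0) ->
  exists F : {additive rel_cohomology Y A k -> W},
    forall z, F (cohomology_class z) = f z.
Proof.
move=> fB f0; pose F0 (xi : rel_cohomology Y A k) := f (repr xi).
have F0E z : F0 (cohomology_class z) = f z.
  apply/eqP; rewrite -subr_eq0 -fB; apply/eqP/f0/cohomology_class_eq.
  by rewrite /cohomology_class reprK.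
have F0B : zmod_morphism F0.
  move=> x y; have [u ->] := cohomology_class_surj x.
  have [v ->] := cohomology_class_surj y.
  by rewrite -cohomology_classB !F0E fB.
pose M := GRing.isZmodMorphism.Build _ _ F0 F0B.
pose F : {additive rel_cohomology Y A k -> W} := HB.pack F0 M.
by exists F.
Qed.

Lemma additive_bijective (U V : zmodType) (f : {additive U -> V}) :
  (forall x, f x = 0 -> x = 0) -> (forall y, exists x, f x = y) -> bijective f.
Proof.
move=> finj /choice[g gK]; exists g => // x; apply/eqP; rewrite -subr_eq0.
by apply/eqP/finj; rewrite raddfB gK subrr.
Qed.

Lemma isomorphic_inv (U V W : zmodType) (f : {additive U -> V}) :
  bijective f -> isomorphic U W -> isomorphic V W.
Proof.
move=> [g fK gK] [k kb].
have gB : zmod_morphism g by exact: can2_zmod_morphism fK gK.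
pose M := GRing.isZmodMorphism.Build _ _ g gB.
pose G : {additive V -> U} := HB.pack g M.
by exists (k \o G)%FUN; apply: bij_comp kb _; exists f.
Qed.
End Cohomology.

(** * The connecting map and the two isomorphisms with 'Z_2 *)

Section DiscIsomorphisms.
Context {R : realType} {X : cellComplex2 R}.
Variable D : cellularDisc X.
Local Notation B := (disc_boundary D).
Hypothesis graphB : is_subgraph B.

Let BD : sub_subcomplex B D := disc_boundary_sub D.
Let finB l : finite_set (B l).
Proof. exact: sub_finite_set (@disc_boundary_sub _ _ D l) (disc_finite D l). Qed.

Lemma sub_coboundary2 (v : cochain D 0) : sub_coboundary (sub_coboundary v) = 0.
Proof.
have -> : sub_coboundary v = restrict (coboundary (extend0 v)) by [].
apply/funext => s; rewrite sub_coboundary_restrict.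
exact: coboundary_coboundary (set_valP s).
Qed.

(** One particular extension, by zero, is used to define the connecting map; any other differs from
    it by a cochain vanishing on B, which does not affect the relative class. *)
Definition extension (c : cochain B 1) : cochain D 1 := restrict (extend0 c).

Lemma extensionP (c : cochain B 1) : extends_cochain c (extension c).
Proof. by move=> s t st; rewrite /extension /restrict st extend0E. Qed.

Lemma extensionB (c d : cochain B 1) : extension (c - d) = extension c - extension d.
Proof.
by apply/funext => s; rewrite /extension /restrict extend0D extend0N.
Qed.

Lemma boundary_cocycle (c : cochain B 1) : c \in is_cocycle B empty_subcomplex 1.
Proof.
apply/andP; split; first by apply/asboolP.
have B2 (s : cell X 2) : ~ B 2 s by rewrite graphB.
by apply/eqP/funext => s; case: (B2 _ (set_valP s)).
Qed.

Definition connecting_cocycle (z : cocycle B empty_subcomplex 1) : cocycle D B 2 :=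
  Cocycle (coboundary_extension_cocycle BD (extensionP z)).

Lemma connecting_exists : exists delta : {additive cohomology B 1 -> rel_cohomology D B 2},
  is_connecting BD delta.
Proof.
have [] := @cohomology_factor _ _ B empty_subcomplex 1 _
  (fun z => cohomology_class (connecting_cocycle z)).
- move=> x y; rewrite -cohomology_classB; congr cohomology_class; apply/val_inj => /=.
  by rewrite extensionB raddfB.
- move=> z /asboolP[b _ zb]; apply/cohomology_class_eq0/asboolP.
  pose b' : cochain D 0 := restrict (extend0 b).
  (* When z is the coboundary of b, its extension need not vanish on B. Subtracting the coboundary
     of b extended by zero makes it vanish there and leaves its own coboundary unchanged. *)
  exists (extension z - sub_coboundary b'); last first.
    by rewrite raddfB/= sub_coboundary2 subr0.
  apply/asboolP => s Bs; rewrite [LHS](_ : _ = extension z s - sub_coboundary b' s)//.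
  rewrite sub_coboundary_restrict /extension /restrict zb.
  rewrite -[val s]/(val (SigSub (mem_set Bs) : B 1)) extend0E.
  by rewrite /sub_coboundary subrr.
move=> delta deltaE; exists delta => c d cd; rewrite deltaE.
apply/cohomology_class_eq/asboolP; exists (extension c - d); last by rewrite raddfB.
apply/asboolP => s Bs; rewrite [LHS](_ : _ = extension c s - d s)//.
rewrite (cd (SigSub (mem_set Bs)) s)// /extension /restrict.
by rewrite -[val s]/(val (SigSub (mem_set Bs) : B 1)) extend0E subrr.
Qed.

Lemma connecting_bijective (delta : {additive cohomology B 1 -> rel_cohomology D B 2}) :
  is_connecting BD delta -> bijective delta.
Proof.
move=> dP; apply: additive_bijective => [xi|zeta].
  have [z ->] := cohomology_class_surj xi.
  rewrite (dP z _ (extensionP z)) => /cohomology_class_eq0/asboolP[b /asboolP b0 /= zb].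
  (* Since b vanishes on B, d is a cocycle of D that still restricts to z; a primitive v of d on D
     restricts to a primitive of z on B. *)
  pose d := extension z - b.
  have d0 f : D 2 f -> coboundary (extend0 d) f = 0.
    move=> Df; have : sub_coboundary d (SigSub (mem_set Df)) = 0.
      by rewrite /d raddfB/= zb subrr.
    by [].
  have [v vE] := disc_H1_trivial graphB d0.
  apply/cohomology_class_eq0/asboolP; exists (restrict v); first exact/asboolP.
  apply/funext => s; rewrite sub_coboundary_restrict.
  have Bs := set_valP s; have Ds := BD Bs.
  rewrite -vE// -[val s]/(val (SigSub (mem_set Ds) : D 1)) extend0E.
  rewrite [RHS](_ : _ = extension z (SigSub (mem_set Ds)) - b (SigSub (mem_set Ds)))//.
  by rewrite b0// subr0 /extension /restrict extend0E.
have [y ->] := cohomology_class_surj zeta.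
(* A primitive d of y on D is itself an extension of its restriction to B, so the class of that
   restriction is a preimage. *)
have [d dE] := disc_H2_trivial graphB (extend0 y).
pose z := Cocycle (boundary_cocycle (restrict d)).
have zd : extends_cochain z (restrict d : cochain D 1).
  by move=> s t st; rewrite /restrict st.
exists (cohomology_class z); rewrite (dP z _ zd); congr cohomology_class.
apply/val_inj/funext => s /=.
by rewrite sub_coboundary_restrict dE ?extend0E//; exact: set_valP.
Qed.

(** The isomorphism is the holonomy around the boundary circle; modulo 2 the orientation of the
    edges does not matter. *)
Lemma boundary_cohomology : isomorphic (cohomology B 1) 'Z_2.
Proof.
pose sum (z : cocycle B empty_subcomplex 1) : 'Z_2 :=
  \sum_(e <- fset_set (B 1)) extend0 z e.
have memB e : (e \in enum_fset (fset_set (B 1))) = `[< B 1 e >].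
  by rewrite in_fset_set; [apply/idP/asboolP; rewrite inE|exact: finB].
have [] := @cohomology_factor _ _ B empty_subcomplex 1 _ sum.
- move=> x y; rewrite /sum -sumrB; apply: eq_bigr => e _.
  by rewrite [cocycle_val _](_ : _ = cocycle_val x - cocycle_val y)// extend0D extend0N.
- move=> z /asboolP[b _ zb]; rewrite /sum -[RHS](boundary_sum_coboundary graphB (extend0 b)).
  apply: eq_big_seq => e; rewrite memB => /asboolP Be.
  by rewrite zb (extend0_restrict (coboundary (extend0 b))).
move=> F FE; exists F; apply: additive_bijective => [xi|x].
  have [z ->] := cohomology_class_surj xi.
  rewrite FE => /(boundary_sum_eq0 graphB)[v vE].
  apply/cohomology_class_eq0/asboolP; exists (restrict v); first exact/asboolP.
  apply/funext => s; rewrite sub_coboundary_restrict -vE ?extend0E//; exact: set_valP.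
have [c c1] := boundary_sum_onto graphB.
exists (cohomology_class (Cocycle (boundary_cocycle (restrict (fun e => x * c e))))).
rewrite FE /sum -[RHS]mulr1 -c1 mulr_sumr; apply: eq_big_seq => e.
by rewrite memB => /asboolP Be; rewrite extend0_restrict.
Qed.
End DiscIsomorphisms.

Theorem mainTheorem5 (R : realType) (X : cellComplex2 R)
    (L : subcomplex X) (L_graph : is_subgraph L) (lambda : cochain L 1)
    (D : cellularDisc X) (D_L : sub_subcomplex (disc_boundary D) L) :
  [/\ exists delta : {additive cohomology (disc_boundary D) 1 ->
                               rel_cohomology D (disc_boundary D) 2},
        is_connecting (disc_boundary_sub D) delta /\ bijective delta,
      isomorphic (cohomology (disc_boundary D) 1) 'Z_2,
      isomorphic (rel_cohomology D (disc_boundary D) 2) 'Z_2 &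
      \sum_(e \in [set e : L 1%N | disc_boundary D 1%N (val e)]) lambda e = 1 ->
      forall lambda' : cell X 1 -> 'Z_2,
        (forall e : L 1%N, lambda' (val e) = lambda e) ->
        \sum_(f \in D 2%N) coboundary lambda' f = 1 /\
        exists2 f : cell X 2, D 2%N f & coboundary lambda' f = 1].
Proof.
have graphB : is_subgraph (disc_boundary D).
  by move=> k k1; apply/seteqP; split=> // s /D_L; rewrite L_graph.
have [delta dP] := connecting_exists D; have db := connecting_bijective graphB dP.
have H1 := boundary_cohomology graphB.
split=> //; [by exists delta|exact: isomorphic_inv db H1|].
move=> lambda1 lambda' lE.
have finB : finite_set (disc_boundary D 1).
  exact: sub_finite_set (@disc_boundary_sub _ _ D 1) (disc_finite D 1).
have sum1 : \sum_(f \in D 2) coboundary lambda' f = 1.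
  rewrite fsbig_finite; last exact: disc_finite.
  rewrite (disc_stokes graphB) -fsbig_finite// -[RHS]lambda1.
  (* The holonomy is summed over edges taken in the subtype of L, the Stokes formula over edges of
     X; [val] matches the two index sets because B is contained in L. *)
  rewrite (@reindex_fsbig _ _ _ _ _ (fun e : L 1 => val e)
    [set e : L 1 | disc_boundary D 1 (val e)]).
    by apply: eq_fsbigr => e _; exact: lE.
  split=> //.
  - by move=> e e' _ _; exact: val_inj.
  - by move=> e Be; exists (SigSub (mem_set (D_L _ _ Be))).
split=> //; apply: contrapT => nf.
move: sum1; rewrite fsbig1 => [/esym/eqP|f Df]; first by rewrite oner_eq0.
have : coboundary lambda' f != 1 by apply/eqP => f1; apply: nf; exists f.
by case: (coboundary lambda' f) => -[|[|//]] i ne; exact/val_inj.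
Qed.
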